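(* Let $G_m$ be a bounded Vilenkin group, i.e. one generated by a sequence $m=(m_0,m_1,\dots)$ of integers $m_k\ge 2$ with $\sup_k m_k<\infty$. Let $\{\Phi_n\}_{n=1}^{\infty}$ be any nondecreasing sequence of real numbers satisfying $\lim_{n\to\infty}\Phi_n=+\infty$. Then for every $p$ with $0<p\le 2$ there exists a martingale $f\in H_p(G_m)$ such that $$\sum_{k=1}^{\infty}\frac{|\widehat f(k)|^{p}\,\Phi_k}{k^{2-p}}=\infty ,$$ and, if moreover $0<p\le 1$, the same $f$ also satisfies $$\sum_{k=1}^{\infty}\frac{\Phi_{M_k}}{M_k^{2/p-2}}\sum_{j=1}^{m_k-1}\left|\widehat f(jM_k)\right|^{2}=\infty ,$$ and, if moreover $0<p<1$, the same $f$ also satisfies $$\sum_{k=1}^{\infty}\frac{\|S_k f\|_{L_{p,\infty}}^{p}\,\Phi_k}{k^{2-p}}=\infty .$$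
   Context: Let $\mathbb N_+$ be the positive integers and $\mathbb N=\mathbb N_+\cup\{0\}$. Let $m=(m_0,m_1,\dots)$ be a sequence of integers $m_k\ge 2$, and let $Z_{m_k}=\{0,1,\dots,m_k-1\}$ be the additive group of integers modulo $m_k$. The Vilenkin group $G_m=\prod_{k\ge 0}Z_{m_k}$ is the complete direct product with the product of the discrete topologies; its elements are written $x=(x_0,x_1,\dots)$ with $x_k\in Z_{m_k}$. It is called bounded if $\sup_k m_k<\infty$. The measure $\mu$ is the product of the uniform probability measures $\mu_k(\{j\})=1/m_k$ on $Z_{m_k}$ (normalized Haar measure). For $x\in G_m$ put $I_0(x)=G_m$ and $I_n(x)=\{y\in G_m: y_0=x_0,\dots,y_{n-1}=x_{n-1}\}$. Let $\mathcal F_n$ be the $\sigma$-algebra generated by $\{I_n(x):x\in G_m\}$, and let $E_n$ be the conditional expectation operator relative to $\mathcal F_n$. Generalized number system: $M_0=1$ and $M_{k+1}=m_kM_k$. Every $n\in\mathbb N$ is uniquely written $n=\sum_{j\ge0}n_jM_j$ with $n_j\in Z_{m_j}$ and only finitely many $n_j\neq0$. Vilenkin system: the generalized Rademacher functions are $r_k(x)=\exp(2\pi \iota x_k/m_k)$ with $\iota^2=-1$, and $\psi_n(x)=\prod_{k\ge0}r_k(x)^{n_k}$ for $n\in\mathbb N$. Martingales: a martingale is a sequence $f=(f^{(n)},n\in\mathbb N)$ of functions $f^{(n)}\in L_1(G_m)$ such that $f^{(n)}$ is $\mathcal F_n$-measurable for all $n$, and $E_nf^{(l)}=f^{(n)}$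 for all $n\le l$. Its maximal function is $f^*=\sup_{n\in\mathbb N}|f^{(n)}|$. For $0<p<\infty$, the martingale Hardy space $H_p=H_p(G_m)$ consists of all martingales $f$ with $\|f\|_{H_p}:=\|f^*\|_{p}<\infty$, where $\|g\|_p=\left(\int_{G_m}|g|^p\,d\mu\right)^{1/p}$. The Vilenkin-Fourier coefficients of a martingale $f$ are $$\widehat f(i)=\lim_{k\to\infty}\int_{G_m}f^{(k)}\,\overline{\psi_i}\,d\mu\qquad(i\in\mathbb N),$$ and its partial sums are $S_nf=\sum_{k=0}^{n-1}\widehat f(k)\psi_k$ for $n\in\mathbb N_+$. For measurable $g$ on $G_m$, $\|g\|_{L_{p,\infty}}=\sup_{\lambda>0}\lambda\,\mu(\{x\in G_m: |g(x)|>\lambda\})^{1/p}$. A series being equal to $\infty$ means that its partial sums tend to $+\infty$. *)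

(* Defs.v *)
From HB Require Import structures.
From mathcomp Require Import all_boot all_order all_algebra.
From mathcomp Require Import complex.
From mathcomp Require Import all_classical all_reals all_analysis.

Set Implicit Arguments.
Unset Strict Implicit.
Unset Printing Implicit Defensive.

Import Order.TTheory GRing.Theory Num.Theory.
Import numFieldNormedType.Exports.

Local Open Scope classical_set_scope.
Local Open Scope ring_scope.

(* 'Z_d is the additive group of integers modulo d only when 1 < d; the
   hypothesis 1 < m k, for all k, is made wherever G_m is used. *)
Definition vseq (m : nat -> nat) := forall k : nat, 'Z_(m k).
HB.instance Definition _ (m : nat -> nat) := gen_eqMixin (vseq m).
HB.instance Definition _ (m : nat -> nat) := gen_choiceMixin (vseq m).
HB.instance Definition _ (m : nat -> nat) :=
  isPointed.Build (vseq m) (fun k => 0 : 'Z_(m k)).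

Definition vcoord (m : nat -> nat) : set (set (vseq m)) :=
  [set A | exists k (B : set 'Z_(m k)), A = [set x : vseq m | B (x k)]].
Arguments vcoord : clear implicits.

(* G_m with the product sigma-algebra of the discrete ones, which is also the
   Borel sigma-algebra of the (second countable) product topology. *)
Notation vilenkin m := (g_sigma_algebraType (vcoord m)).

Definition bounded_seq (m : nat -> nat) := exists C : nat, forall k, (m k <= C)%N.

(* mu is the product of the uniform probabilities: a finite-dimensional box
   A_0 x ... x A_(n-1) has the product of the #|A_k| / m_k as its measure. This
   determines mu uniquely; existence is product_uniform_exists below. *)
Definition product_uniform (R : realType) (m : nat -> nat)
    (mu : probability (vilenkin m) R) :=
  forall (n : nat) (A : forall k : nat, {set 'Z_(m k)}),
    mu [set x | forall k, (k < n)%N -> x k \in A k] =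
    (\prod_(k < n) (#|A k|%:R / (m k)%:R))%:E.

Definition vI (m : nat -> nat) (n : nat) (x : vilenkin m) : set (vilenkin m) :=
  [set y | forall k, (k < n)%N -> y k = x k].

Definition vcells (m : nat -> nat) (n : nat) : set (set (vilenkin m)) :=
  [set vI n x | x in setT].
Arguments vcells : clear implicits.

Fixpoint vM (m : nat -> nat) (k : nat) : nat :=
  if k is k'.+1 then (m k' * vM m k')%N else 1%N.

Definition vdigit (m : nat -> nat) (n k : nat) : nat := ((n %/ vM m k) %% m k)%N.

Definition rademacher (R : realType) (m : nat -> nat) (k : nat)
    (x : vilenkin m) : R[i] :=
  let t := 2 * pi * (x k : nat)%:R / (m k)%:R : R in (cos t +i* sin t)%C.
Arguments rademacher R {m} k x.

(* The product over all k >= 0 stops at n, as the digits of n of index >= n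
   vanish (vdigit_eq0 below). *)
Definition psi (R : realType) (m : nat -> nat) (n : nat)
    (x : vilenkin m) : R[i] :=
  \prod_(k < n) rademacher R k x ^+ vdigit m n k.
Arguments psi R {m} n x.

Notation cmod := ComplexField.Normc.normc.

Section complex_functions.
Variables (R : realType) (m : nat -> nat) (mu : probability (vilenkin m) R).
Implicit Types (A : set (vilenkin m)) (g h : vilenkin m -> R[i]).
Implicit Type f : nat -> vilenkin m -> R[i].

Definition cintegrable g :=
  mu.-integrable setT (EFin \o (fun x => complex.Re (g x))) /\
  mu.-integrable setT (EFin \o (fun x => complex.Im (g x))).

Definition cintegral A g : R[i] :=
  ((\int[mu]_(x in A) complex.Re (g x)) +i*
   (\int[mu]_(x in A) complex.Im (g x)))%C.

Definition clim (u : nat -> R[i]) : R[i] :=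
  (lim ((fun k => complex.Re (u k)) @ \oo) +i*
   lim ((fun k => complex.Im (u k)) @ \oo))%C.

(* Measurability with respect to F_n = <<s vcells m n >>. *)
Definition Fmeasurable (n : nat) g :=
  measurable_fun (setT : set (g_sigma_algebraType (vcells m n)))
    (fun x => complex.Re (g x)) /\
  measurable_fun (setT : set (g_sigma_algebraType (vcells m n)))
    (fun x => complex.Im (g x)).

(* E_n g = h. No nonempty set of F_n is negligible, so h is unique everywhere,
   not only almost everywhere. *)
Definition cond_exp_is (n : nat) g h :=
  [/\ Fmeasurable n h, cintegrable h &
      forall A, <<s vcells m n >> A -> cintegral A h = cintegral A g].

Definition martingale f :=
  (forall n, cintegrable (f n) /\ Fmeasurable n (f n)) /\
  (forall n l, (n <= l)%N -> cond_exp_is n (f l) (f n)).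

Definition maximal f (x : vilenkin m) : \bar R :=
  ereal_sup [set (cmod (f n x))%:E | n in setT].

Definition hardy (p : R) f :=
  martingale f /\ (Lnorm mu p%:E (maximal f) < +oo)%E.

Definition fcoef f (i : nat) : R[i] :=
  clim (fun k => cintegral setT (fun x => f k x * (psi R i x)^*%C)).

Definition fsum f (n : nat) (x : vilenkin m) : R[i] :=
  \sum_(k < n) fcoef f k * psi R k x.

Definition weak_norm (p : R) g : \bar R :=
  ereal_sup [set (l%:E * (mu [set x | (l < cmod (g x))%R]) `^ p^-1)%E
            | l in [set l : R | 0 < l]].

End complex_functions.

(* The series of the u k over k >= 1 equals +oo, the terms (of any sign) being
   in \bar R. *)
Definition series_pinfty (R : realType) (u : nat -> \bar R) :=
  (fun n => (\sum_(1 <= k < n.+1) u k)%E) @ \oo --> +oo%E.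

Section generalized_number_system.
Variable m : nat -> nat.
Hypothesis m2 : forall k, (1 < m k)%N.

Lemma vM_gt0 k : (0 < vM m k)%N.
Proof. by elim: k => //= k IH; rewrite muln_gt0 (ltnW (m2 k)). Qed.

Lemma vM_gt k : (k < vM m k)%N.
Proof.
elim: k => //= k IH; apply: (@leq_trans (2 * vM m k)); last first.
  by rewrite leq_mul2r m2 orbT.
by rewrite mul2n -addnn -addn1 leq_add // vM_gt0.
Qed.

Lemma vdigit_lt n k : (vdigit m n k < m k)%N.
Proof. by rewrite ltn_pmod // (ltnW (m2 k)). Qed.

Lemma vdigit_eq0 n k : (n <= k)%N -> vdigit m n k = 0%N.
Proof.
by move=> nk; rewrite /vdigit divn_small ?mod0n // (leq_ltn_trans nk) ?vM_gt.
Qed.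

Lemma vdigit_sum n : n = (\sum_(k < n) vdigit m n k * vM m k)%N.
Proof.
suff H k : (n %% vM m k = \sum_(j < k) vdigit m n j * vM m j)%N.
  by rewrite -H modn_small ?vM_gt.
elim: k => [|k IH] /=; first by rewrite big_ord0 modn1.
rewrite big_ord_recr /= -IH /vdigit addnC.
rewrite {1}(divn_eq n (vM m k)) {1}(divn_eq (n %/ vM m k) (m k)) mulnDl -mulnA.
rewrite -addnA modnMDl modn_small // (@leq_trans ((n %/ vM m k %% m k).+1 * vM m k)) //.
  by rewrite mulSn addnC ltn_add2r ltn_mod vM_gt0.
by rewrite leq_mul2r ltn_pmod ?orbT // (ltnW (m2 k)).
Qed.

End generalized_number_system.

Section product_uniform_existence.
Variables (R : realType) (m : nat -> nat).
Hypothesis m2 : forall k, (1 < m k)%N.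

Let t (n : nat) (x : R) : nat := Num.truncn (x * (vM m n)%:R).
(* Digits of the base-m expansion of x in [0, 1[. *)
Let d (x : R) : vilenkin m := fun k => inZp (t k.+1 x).
Let P : probability (measurableTypeR R) R := uniform_prob (@ltr01 R).
Let cell n (S : seq nat) := [set x : R | 0 <= x < 1 /\ t n x \in S].

Let vMr_gt0 n : 0 < (vM m n)%:R :> R.
Proof. by rewrite ltr0n vM_gt0. Qed.

Let t_eq n x s : 0 <= x ->
  (t n x == s) = (s%:R / (vM m n)%:R <= x < s.+1%:R / (vM m n)%:R).
Proof.
move=> x0; rewrite /t truncn_eq ?mulr_ge0 //.
by rewrite ler_pdivrMr // ltr_pdivlMr.
Qed.

Let t_lt n x : 0 <= x < 1 -> (t n x < vM m n)%N.
Proof.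
move=> /andP[x0 x1]; rewrite /t truncn_lt_nat ?mulr_ge0 //.
by rewrite gtr_pMl.
Qed.

Let t_div n x : 0 <= x -> t n x = (t n.+1 x %/ m n)%N.
Proof.
move=> x0; apply/eqP; rewrite /t truncn_eq ?mulr_ge0 //=.
have mn : 0 < (m n)%:R :> R by rewrite ltr0n (ltnW (m2 n)).
set z := Num.truncn _.
have /andP[z1 z2] : z%:R <= x * (m n * vM m n)%:R < z.+1%:R.
  by rewrite truncn_itv // mulr_ge0.
apply/andP; split.
  rewrite -(ler_pM2r mn) -mulrA -!natrM (mulnC (vM m n)).
  by apply: le_trans z1; rewrite ler_nat leq_divM.
rewrite -(ltr_pM2r mn) -mulrA -!natrM (mulnC (vM m n)).
by apply: lt_le_trans z2 _; rewrite ler_nat ltn_ceil // (ltnW (m2 n)).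
Qed.

Let P_itv n s : (s < vM m n)%N ->
  P (`[s%:R / (vM m n)%:R, s.+1%:R / (vM m n)%:R[)%classic =
  ((vM m n)%:R^-1)%:E.
Proof.
move=> sM; rewrite /= /uniform_prob.
rewrite (eq_integral (fun=> 1%:E)); last first.
  move=> x; rewrite inE /= in_itv /= => /andP[x0 x1]; rewrite /uniform_pdf.
  rewrite (le_trans _ x0) ?divr_ge0 //= (le_trans (ltW x1)).
    by rewrite subr0 invr1.
  by rewrite ler_pdivrMr // mul1r ler_nat.
rewrite integral_cst //= mul1e lebesgue_measure_itv /= lte_fin.
rewrite ltr_pM2r ?invr_gt0 // ltr_nat ltnSn -EFinB -mulrBl -natrB //.
by rewrite subSnn mul1r.
Qed.

Let cell1 n s : (s < vM m n)%N ->
  cell n [:: s] = (`[s%:R / (vM m n)%:R, s.+1%:R / (vM m n)%:R[)%classic.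
Proof.
move=> sM; apply/seteqP; split => x; rewrite /cell /= in_itv /=.
  by move=> [/andP[x0 _]]; rewrite inE t_eq.
move=> xs; have /andP[x0 x1] := xs.
have x0' : 0 <= x by rewrite (le_trans _ x0) ?divr_ge0.
split; last by rewrite inE t_eq.
rewrite x0' (lt_le_trans x1) //.
by rewrite ler_pdivrMr // mul1r ler_nat.
Qed.

Let P_cell n S : uniq S -> all (fun s => s < vM m n)%N S ->
  measurable (cell n S) /\ P (cell n S) = ((size S)%:R / (vM m n)%:R)%:E.
Proof.
elim: S => [_ _|s S IH /= /andP[sS uS] /andP[sM SM]].
  have -> : cell n [::] = set0 by apply/seteqP; split => x //= [].
  by rewrite measure0 mul0r; split.
have -> : cell n (s :: S) = cell n [:: s] `|` cell n S.
  apply/seteqP; split => x; rewrite /cell /=.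
    by move=> [x01]; rewrite !inE => /orP[/eqP->|]; [left|right]; rewrite ?inE.
  by move=> [[x01]|[x01]]; rewrite !inE; [move=> ->|move=> ->; rewrite orbT].
have [mS PS] := IH uS SM.
have m1 : measurable (cell n [:: s]) by rewrite cell1.
split; first exact: measurableU.
have P1 : P (cell n [:: s]) = ((vM m n)%:R^-1)%:E by rewrite cell1 // P_itv.
rewrite measureU //.
  rewrite [LHS](congr2 (fun a b => a + b)%E P1 PS) -EFinD -natr1.
  by rewrite mulrDl mul1r addrC.
apply/seteqP; split => x //=.
by rewrite /cell /= !inE => -[[_ /eqP->]] [_]; rewrite (negbTE sS).
Qed.

Let box n (A : forall k : nat, {set 'Z_(m k)}) :
  exists S : seq nat, [/\ uniq S, all (fun s => s < vM m n)%N S,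
    (size S)%:R / (vM m n)%:R = \prod_(k < n) (#|A k|%:R / (m k)%:R) :> R &
    forall x, 0 <= x < 1 ->
      (forall k, (k < n)%N -> d x k \in A k) <-> t n x \in S].
Proof.
elim: n => [|n [S [uS SM sS SP]]].
  exists [:: 0%N]; split => //=; first by rewrite big_ord0 divr1.
  by move=> x x01; have := t_lt 0 x01; rewrite ltnS leqn0 inE => ->.
have mn0 : (0 < m n)%N by rewrite (ltnW (m2 n)).
have Zm : (Zp_trunc (m n)).+2 = m n by rewrite Zp_cast.
exists [seq (s * m n + nat_of_ord j)%N | s <- S, j <- enum (A n)]; split.
- apply: allpairs_uniq => //; first exact: enum_uniq.
  move=> [s j] [s' j'] /= _ _ e.
  have lt (i : 'Z_(m n)) : (i < m n)%N by rewrite -[X in (_ < X)%N]Zm.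
  have := congr1 (divn^~ (m n)) e; rewrite !divnMDl // !divn_small // !addn0.
  move=> es; move: e; rewrite es => /addnI /val_inj -> //.
- apply/allP => z /allpairsP[[s j] /= [sS' _ ->]].
  have sM := allP SM _ sS'.
  have lj : (j < m n)%N by rewrite -[X in (_ < X)%N]Zm.
  apply: (@leq_trans (s.+1 * m n)); first by rewrite mulSn addnC ltn_add2r.
  by rewrite mulnC leq_mul2l sM orbT.
- by rewrite size_allpairs -cardE big_ord_recr /= -sS mulf_div -!natrM
    (mulnC (vM m n)).
- move=> x x01; have x0 : 0 <= x by case/andP: x01.
  have tE := t_div n x0.
  split=> [dA|/allpairsP[[s j] /= [sS' jA te]] k].
    apply/allpairsP; exists (t n x, d x n); split => /=.
    + by apply/SP => // k kn; apply: dA; rewrite ltnW.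
    + by rewrite mem_enum; apply: dA.
    + by rewrite tE {1}(divn_eq (t n.+1 x) (m n)) /d /= [in RHS]Zm.
  have lj : (j < m n)%N by rewrite -[X in (_ < X)%N]Zm.
  rewrite ltnS leq_eqVlt => /orP[/eqP->|kn].
    rewrite mem_enum in jA; suff -> : d x n = j by [].
    by apply/val_inj; rewrite /d /= te [X in (_ %% X)%N]Zm modnMDl modn_small.
  have /SP : t n x \in S by rewrite tE te divnMDl // divn_small // addn0.
  by apply.
Qed.

Let measurable_d : measurable_fun (setT : set (measurableTypeR R)) d.
Proof.
apply: (@measurability _ _ (measurableTypeR R) (vilenkin m) setT d (vcoord m) erefl) => _ [_ [k [B ->]] <-].
rewrite setTI.
have -> : d @^-1` [set x : vseq m | B (x k)] =
   \bigcup_(s in [set s | B (inZp s)]) (t k.+1 @^-1` [set s]).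
  apply/seteqP; split => x /=; first by move=> Bx; exists (t k.+1 x).
  by move=> [s Bs ts]; rewrite /d; move: ts => /= ->.
apply: bigcup_measurable => s _; move: k.+1 => q.
have cut c : measurable [set x : R | x * (vM m q)%:R < c].
  have -> : [set x : R | x * (vM m q)%:R < c] =
      (`]-oo, c / (vM m q)%:R[)%classic.
    by apply/seteqP; split => x; rewrite set_itvE /= ltr_pdivlMr ?vMr_gt0.
  exact: measurable_itv.
have -> : t q @^-1` [set s] = [set x : R | x * (vM m q)%:R < s.+1%:R] `\`
    (if s is s'.+1 then [set x : R | x * (vM m q)%:R < s'.+1%:R] else set0).
  apply/seteqP; split => x /=.
    move=> <-; rewrite -real_truncn_le_nat ?num_real //; split => //.
    case e : (t q x) => [|s'] //=.
    by rewrite -real_truncn_le_nat ?num_real // -/(t q x) e ltnn.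
  rewrite -real_truncn_le_nat ?num_real // -/(t q x).
  case: s => [|s] [+ h]; first by rewrite leqn0 => /eqP.
  rewrite leq_eqVlt => /orP[/eqP//|]; rewrite ltnS.
  by rewrite /t real_truncn_le_nat ?num_real.
apply: measurableD; first exact: cut.
by case: s => [|s]; [exact: measurable0|exact: cut].
Qed.

Lemma product_uniform_exists :
  exists mu : probability (vilenkin m) R, product_uniform mu.
Proof.
pose X : {mfun (measurableTypeR R) >-> (vilenkin m)} :=
  @mfun_Sub _ _ (measurableTypeR R) (vilenkin m) d
    (@mem_set _ (fun f => measurable_fun _ f) d measurable_d).
exists (distribution P X) => n A.
have mC : measurable (`[0, 1[%classic : set R) by [].
have PC : P (`[0, 1[%classic) = 1%E.
  by rewrite -[X in X%:E]invr1 -(@P_itv 0 0) //= mul0r divr1.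
have mA : measurable [set x : vilenkin m | forall k, (k < n)%N -> x k \in A k].
  have -> : [set x : vilenkin m | forall k, (k < n)%N -> x k \in A k] =
      \bigcap_(k in `I_n) [set x : vilenkin m | x k \in A k].
    by apply/seteqP; split => x.
  rewrite bigcap_mkord; apply: bigsetI_measurable => k _.
  apply: sub_sigma_algebra.
  by exists (k : nat), [set i | i \in A k].
have mB := measurable_d measurableT mA; rewrite setTI in mB.
have [S [uS SM sS SP]] := box n A; have [mS PS] := P_cell uS SM.
rewrite /distribution /pushforward /= -sS -PS.
have PD : P (X @^-1` [set x : vilenkin m | forall k, (k < n)%N -> x k \in A k]
    `\` `[0, 1[%classic) = 0%E.
  apply/eqP; rewrite eq_le measure_ge0 andbT.
  have <- : P (~` `[0, 1[%classic) = 0%E.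
    by rewrite probability_setC // PC subee.
  by apply: le_measure; rewrite ?inE;
    [exact: measurableD|exact: measurableC|move=> x []].
apply: (etrans (measureDI P mB mC)).
apply: (etrans (congr2 (fun a b => a + b)%E PD erefl)); rewrite add0e.
congr (P _).
apply/seteqP; split => x; rewrite /cell /= in_itv /=.
  by move=> [xA x01]; split => //; exact/(SP _ x01).
by move=> [x01 xS]; split => //; exact/(SP _ x01).
Qed.

End product_uniform_existence.

(* Main.v *)
Require Import Defs.
From HB Require Import structures.
From mathcomp Require Import all_boot all_order all_algebra.
From mathcomp Require Import complex.
From mathcomp Require Import all_classical all_reals all_analysis.
From mathcomp Require Import measurable_realfun ring lra.

Set Implicit Arguments.
Unset Strict Implicit.
Unset Printing Implicit Defensive.

Import Order.TTheory GRing.Theory Num.Theory.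
Import numFieldNormedType.Exports.

Local Open Scope classical_set_scope.
Local Open Scope ring_scope.

(**
  Write D_n = M_n 1_{I_n(0)}, the Dirichlet kernel of order M_n, and take
    f^(n) = sum_(k < n) b_k (D_(k+1) - D_k),
    b_k = w_k M_k^(1/p - 1),  w_k = v_k^(1 + 1/p).
  The k-th increment is the block of characters psi_i, M_k <= i < M_(k+1), so
  the i-th coefficient of f is b_k on that block. Since m is bounded by some C,
    |f^(n)| <= C sum_(k < n) v_k (v_k D_k)^(1/p),
  hence |f^(n)|^p <= (C sum_k v_k)^p sum_k v_k D_k, whose integral is finite as
  soon as sum_k v_k is. The v_k vanish outside a sparse set of levels on which
  Phi (M_k) w_k^2 is unbounded, and one such block already makes the partial
  sums of each series at least a constant times Phi (M_k) w_k^2: for the first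
  and third series the indices of [M_k, 2 M_k[ suffice, because w_k <= 1 and
  p <= 2 give w_k^p >= w_k^2. For the third one, coefficients are constant on
  the groups of m_0 consecutive indices, over which the characters sum to 0 at
  each x with x_0 <> 0; so |S_(t m_0 + 1) f| = b_k on that set.
*)

(** Serves to split off the top digit of the indices below M_(n+1), with d = M_n, and to gather
    indices m_0 at a time, with d = m_0. *)
Lemma big_nat_blocks (V : nmodType) (a b d : nat) (F : nat -> V) :
  (a <= b)%N ->
  \sum_(a * d <= k < b * d) F k =
  \sum_(a <= t < b) \sum_(0 <= j < d) F (t * d + j)%N.
Proof.
elim: b => [|b IH]; first by rewrite leqn0 => /eqP ->; rewrite !big_geq.
rewrite leq_eqVlt => /predU1P[->|]; first by rewrite !big_geq.
rewrite ltnS => ab; rewrite big_nat_recr //= -IH //.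
rewrite (big_cat_nat (n := (b * d)%N)) ?leq_mul //=; congr (_ + _).
rewrite -{1}[(b * d)%N]add0n big_addn mulSn addnK.
by apply: eq_bigr => j _; rewrite addnC.
Qed.

(** * Digits and functions of finitely many coordinates *)

Section digits.
Variable m : nat -> nat.
Hypothesis m2 : forall k, (1 < m k)%N.

Let m_gt0 k : (0 < m k)%N. Proof. exact: ltnW. Qed.

Lemma vM_dvd k n : (k <= n)%N -> (vM m k %| vM m n)%N.
Proof.
elim: n => [|n IH]; first by rewrite leqn0 => /eqP ->.
by rewrite leq_eqVlt => /predU1P[->//|/IH] /= h; rewrite dvdn_mull.
Qed.

Lemma leq_vM k n : (k <= n)%N -> (vM m k <= vM m n)%N.
Proof. by move=> kn; rewrite dvdn_leq ?vM_gt0 ?vM_dvd. Qed.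

Lemma vdigitD_low s d k n : (k < n)%N ->
  vdigit m (s + d * vM m n) k = vdigit m s k.
Proof.
move=> kn; have /dvdnP[q ->] := vM_dvd kn.
rewrite /vdigit /= (mulnA q) (mulnA d) divnDMl ?vM_gt0 // mulnA.
by rewrite addnC modnMDl.
Qed.

Lemma vdigitD_top s d n : (s < vM m n)%N -> (d < m n)%N ->
  vdigit m (s + d * vM m n) n = d.
Proof.
by move=> sn dn; rewrite /vdigit divnDMl ?vM_gt0 // divn_small // modn_small.
Qed.

Lemma vM_split n s : (s < vM m n.+1)%N ->
  exists s' d, [/\ s = (s' + d * vM m n)%N, (s' < vM m n)%N & (d < m n)%N].
Proof.
move=> sM; exists (s %% vM m n)%N, (s %/ vM m n)%N; split.
- by rewrite addnC -divn_eq.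
- by rewrite ltn_mod vM_gt0.
- by rewrite ltn_divLR ?vM_gt0.
Qed.

Lemma vdigit_inj n s s' : (s < vM m n)%N -> (s' < vM m n)%N ->
  (forall k, (k < n)%N -> vdigit m s k = vdigit m s' k) -> s = s'.
Proof.
elim: n s s' => [|n IH] s s'; first by rewrite !ltnS !leqn0 => /eqP-> /eqP->.
move=> /vM_split[t [d [-> tn dn]]] /vM_split[t' [d' [-> tn' dn']]] h.
have := h n (ltnSn _); rewrite !vdigitD_top // => ->; congr addn.
apply: IH => // k kn; have := h k (ltnW kn); rewrite !vdigitD_low //.
Qed.

Lemma level_exists i : (0 < i)%N -> exists n, (vM m n <= i < vM m n.+1)%N.
Proof.
move=> i0; have : (i < vM m i)%N by exact: vM_gt.
elim: {2}i => [|n IH]; first by rewrite /= ltnNge i0.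
by case: (ltnP i (vM m n)) => [/IH //|h h']; exists n; rewrite h h'.
Qed.

Lemma level_uniq i k n : (vM m k <= i < vM m k.+1)%N ->
  (vM m n <= i < vM m n.+1)%N -> k = n.
Proof.
move=> /andP[k1 k2] /andP[n1 n2].
apply/eqP; rewrite eqn_leq; apply/andP; split; rewrite leqNgt;
  apply/negP => /leq_vM.
  by move=> /(leq_trans n2); rewrite ltnNge k1.
by move=> /(leq_trans k2); rewrite ltnNge n1.
Qed.

(* As s ranges over s < M_n, word s is a set of representatives of the cells of
   level n (wordP, word_inj). *)
Definition word (s : nat) : vilenkin m := fun k => inZp (vdigit m s k).

Lemma val_word s k : word s k = vdigit m s k :> nat.
Proof.
by rewrite /word /= Zp_cast // modn_small // vdigit_lt.
Qed.

(** A pointwise substitute for F_n-measurability: such a function is determined by its values at the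
    M_n points [word s], so its integrals become finite sums. *)
Definition local (n : nat) (T : Type) (g : vilenkin m -> T) :=
  forall x y, (forall k, (k < n)%N -> x k = y k) -> g x = g y.

Lemma vlt_ord k (d : 'Z_(m k)) : (d < m k)%N.
Proof. by have := ltn_ord d; rewrite [X in (_ < X)%N]Zp_cast. Qed.

Lemma wordP n (x : vilenkin m) :
  exists2 s, (s < vM m n)%N & forall k, (k < n)%N -> x k = word s k.
Proof.
elim: n => [|n [s sn IH]]; first by exists 0%N.
exists (s + x n * vM m n)%N.
  apply: (@leq_trans ((x n).+1 * vM m n)); first by rewrite mulSn ltn_add2r.
  by rewrite /= leq_mul2r vlt_ord orbT.
move=> k; rewrite ltnS leq_eqVlt => /predU1P[->|kn]; apply: ord_inj.
  by rewrite val_word vdigitD_top // vlt_ord.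
by rewrite (IH k kn) !val_word vdigitD_low.
Qed.

Lemma word_inj n s s' : (s < vM m n)%N -> (s' < vM m n)%N ->
  (forall k, (k < n)%N -> word s k = word s' k) -> s = s'.
Proof.
move=> sn sn' h; apply: (vdigit_inj sn sn') => k kn.
by rewrite -!val_word h.
Qed.

Lemma local_le k n T (g : vilenkin m -> T) : (k <= n)%N ->
  local k g -> local n g.
Proof. by move=> kn lg x y h; apply: lg => j jk; apply/h/(leq_trans jk). Qed.

Lemma local_word n T (g : vilenkin m -> T) s d : local n g ->
  g (word (s + d * vM m n)) = g (word s).
Proof.
by move=> lg; apply: lg => k kn; apply: ord_inj; rewrite !val_word vdigitD_low.
Qed.

End digits.

(** * Integration of functions of finitely many coordinates *)

Section integral.
Variables (R : realType) (m : nat -> nat).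
Hypothesis m2 : forall k, (1 < m k)%N.
Variable mu : probability (vilenkin m) R.
Hypothesis mu_haar : product_uniform mu.

Lemma vI_local n (x : vilenkin m) : local n (vI n x).
Proof.
by move=> y z yz; apply/propext; split => h k kn; rewrite -h // yz.
Qed.

Lemma local_cells n (A : set (vilenkin m)) : local n A ->
  A = \bigcup_(s in [set s | A (word m s)]) vI n (word m s).
Proof.
move=> lA; apply/seteqP; split => x.
  have [s _ xs] := wordP m2 n x; exists s => //=.
  by rewrite -(lA _ _ xs).
by move=> [s /= As xs]; rewrite (lA _ _ xs).
Qed.

Lemma measurable_vI n (x : vilenkin m) : measurable (vI n x).
Proof.
have -> : vI n x = \bigcap_(k in `I_n) [set y : vilenkin m | y k = x k].
  by apply/seteqP; split.
rewrite bigcap_mkord; apply: bigsetI_measurable => k _.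
by apply: sub_sigma_algebra; exists (k : nat), [set x k].
Qed.

Lemma local_measurable n (A : set (vilenkin m)) : local n A -> measurable A.
Proof.
move=> /local_cells ->; apply: bigcup_measurable => s _.
exact: measurable_vI.
Qed.

Lemma local_Fset n (A : set (vilenkin m)) : local n A -> <<s vcells m n >> A.
Proof.
move=> /local_cells ->.
apply: (@bigcup_measurable _ (g_sigma_algebraType (vcells m n))) => s _.
by apply: sub_sigma_algebra; exists (word m s).
Qed.

(** The sets that are [local n] form a sigma-algebra containing the cells. With [local_Fset], this
    identifies them with F_n. *)
Lemma Fset_local n (A : set (vilenkin m)) : <<s vcells m n >> A -> local n A.
Proof.
have : <<s vcells m n >> `<=` [set A | local n A].
  apply: smallest_sub.
    split => [x y//|B lB x y xy|F lF x y xy].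
      by apply/propext; split => -[_ nB]; split=> // ?; apply: nB;
        rewrite ?(lB _ _ xy) // -(lB _ _ xy).
    by apply/propext; split => -[i _ Fi]; exists i => //;
      rewrite ?(lF i _ _ xy) // -(lF i _ _ xy).
  by move=> _ [x _ <-]; exact: vI_local.
by move=> h /h.
Qed.

Lemma local_preimage n T (g : vilenkin m -> T) (B : set T) :
  local n g -> local n (g @^-1` B).
Proof. by move=> lg x y /lg; rewrite /preimage /= => ->. Qed.

Lemma local_Fmeasurable n (g : vilenkin m -> R[i]) :
  local n g -> Fmeasurable n g.
Proof.
move=> lg; split => _ B _; rewrite setTI; apply: local_Fset.
  by move=> x y xy; rewrite /preimage /= (lg _ _ xy).
by move=> x y xy; rewrite /preimage /= (lg _ _ xy).
Qed.

Lemma local_measurable_fun n d (T : measurableType d) (g : vilenkin m -> T) :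
  local n g -> measurable_fun setT g.
Proof.
move=> lg _ B _; rewrite setTI.
exact: (local_measurable (local_preimage B lg)).
Qed.

Lemma local_indic n (A : set (vilenkin m)) :
  local n A -> local n (\1_A : vilenkin m -> R).
Proof.
move=> lA x y xy; rewrite !indicE; congr (nat_of_bool _)%:R.
by apply/idP/idP; rewrite !in_setE (lA _ _ xy).
Qed.

Lemma mu_vI n (x : vilenkin m) : mu (vI n x) = ((vM m n)%:R^-1)%:E.
Proof.
have -> : vI n x = [set y | forall k, (k < n)%N -> y k \in [set x k]%SET].
  by apply/seteqP; split => y h k kn; have := h k kn; rewrite !inE => /eqP.
rewrite mu_haar; congr EFin.
elim: n => [|n IH]; first by rewrite big_ord0 invr1.
by rewrite big_ord_recr /= IH cards1 natrM invfM mul1r mulrC.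
Qed.

(** The cells of level n partition the group, so exactly one term survives; this exhibits g as a
    simple function. *)
Lemma local_expand n (g : vilenkin m -> R) x : local n g ->
  g x = \sum_(s < vM m n) g (word m s) * \1_(vI n (word m s)) x.
Proof.
move=> lg; have [s sn xs] := wordP m2 n x.
rewrite (bigD1 (Ordinal sn)) //= big1 => [|t ts]; last first.
  rewrite indicE memNset ?mulr0 // => xt; move/negP: ts; apply.
  apply/eqP/ord_inj/(word_inj m2 (ltn_ord t) sn) => k kn.
  by rewrite -xt // xs.
by rewrite indicE mem_set // mulr1 addr0 (lg _ _ xs).
Qed.

Lemma local_expand_EFin n (g : vilenkin m -> R) : local n g ->
  EFin \o g = fun x =>
    (\sum_(s < vM m n) (g (word m s))%:E * (\1_(vI n (word m s)) x)%:E)%E.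
Proof.
by move=> lg; apply/funext => x; rewrite /= {1}(local_expand x lg) -sumEFin.
Qed.

Lemma integrable_vI c n (x : vilenkin m) :
  mu.-integrable setT (fun y => (c%:E * (\1_(vI n x) y)%:E)%E).
Proof.
by apply: integrableZl => //; apply: integrable_indic; exact: measurable_vI.
Qed.

Lemma local_integrable n (g : vilenkin m -> R) :
  local n g -> mu.-integrable setT (EFin \o g).
Proof.
move=> lg; rewrite (local_expand_EFin lg).
by apply: integrable_sum => //= s _; exact: integrable_vI.
Qed.

Lemma local_Rintegral n (g : vilenkin m -> R) : local n g ->
  \int[mu]_x g x = (vM m n)%:R^-1 * \sum_(0 <= s < vM m n) g (word m s).
Proof.
move=> lg; rewrite /Rintegral.
rewrite -[fun x => (g x)%:E]/(EFin \o g) (local_expand_EFin lg).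
rewrite integral_sum //=; last by move=> s; exact: integrable_vI.
rewrite (eq_bigr (fun s : 'I_(vM m n) =>
    (g (word m s) / (vM m n)%:R)%:E)) => [|s _].
  rewrite sumEFin /= big_mkord mulr_sumr.
  by apply: eq_bigr => s _; rewrite mulrC.
rewrite integralZl //; last by apply: integrable_indic; exact: measurable_vI.
rewrite integral_indic //; last exact: measurable_vI.
by rewrite setIT EFinM; congr (_ * _)%E; exact: mu_vI.
Qed.

Definition mean n (g : vilenkin m -> R[i]) : R[i] :=
  (vM m n)%:R^-1 * \sum_(0 <= s < vM m n) g (word m s).

Lemma ReD (x y : R[i]) : complex.Re (x + y) = complex.Re x + complex.Re y.
Proof. by case: x y => a b []. Qed.

Lemma ImD (x y : R[i]) : complex.Im (x + y) = complex.Im x + complex.Im y.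
Proof. by case: x y => a b []. Qed.

Lemma local_cintegral n (g : vilenkin m -> R[i]) : local n g ->
  cintegral mu setT g = mean n g.
Proof.
move=> lg; rewrite /cintegral /mean.
rewrite (@local_Rintegral n) => [|x y xy]; last by rewrite (lg _ _ xy).
rewrite (@local_Rintegral n) => [|x y xy]; last by rewrite (lg _ _ xy).
have -> : (vM m n)%:R^-1 = ((vM m n)%:R^-1 : R)%:C%C :> R[i].
  by rewrite fmorphV rmorph_nat.
rewrite -(big_morph (@complex.Re R) (id1 := 0) (id2 := 0) ReD) //.
rewrite -(big_morph (@complex.Im R) (id1 := 0) (id2 := 0) ImD) //.
by case: (\sum_(_ <= _ < _) _) => a b; simpc.
Qed.

Lemma local_cintegrable n (g : vilenkin m -> R[i]) : local n g ->
  cintegrable mu g.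
Proof.
move=> lg; split; apply: (@local_integrable n) => x y xy;
  by rewrite (lg _ _ xy).
Qed.

Lemma cintegral_restrict (A : set (vilenkin m)) (g : vilenkin m -> R[i]) :
  cintegral mu A g = cintegral mu setT (fun x => (\1_A x)%:C%C * g x).
Proof.
rewrite /cintegral Rintegral_mkcond [X in (_ +i* X)%C]Rintegral_mkcond.
congr (_ +i* _)%C; apply: eq_Rintegral => x _; rewrite patchE indicE;
  case: ifP => _; case: (g x) => a b; simpc; by [].
Qed.

(** Independence of x_n from the first n coordinates: in an index s + d M_n, the factor h sees only
    s and the factor c sees only d. *)
Lemma mean_coord n (h : vilenkin m -> R[i]) (c : nat -> R[i]) :
  local n h ->
  mean n.+1 (fun x => h x * c (x n)) =
  mean n h * ((m n)%:R^-1 * \sum_(0 <= d < m n) c d).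
Proof.
move=> lh; rewrite /mean /= natrM invfM.
have -> : \sum_(0 <= s < m n * vM m n) h (word m s) * c (word m s n) =
    (\sum_(0 <= s < vM m n) h (word m s)) * \sum_(0 <= d < m n) c d.
  rewrite -[X in \sum_(X <= _ < _) _](mul0n (vM m n)) big_nat_blocks //.
  rewrite mulr_sumr; apply: eq_big_nat => d /andP[_ dm].
  rewrite mulr_suml; apply: eq_big_nat => s /andP[_ sM].
  rewrite addnC local_word //; congr (_ * c _).
  by rewrite val_word // vdigitD_top.
by rewrite (mulrC (m n)%:R^-1) mulrACA.
Qed.

End integral.

(** * Characters *)

Section characters.
Variables (R : realType) (m : nat -> nat).
Hypothesis m2 : forall k, (1 < m k)%N.

Let m_gt0 k : (0 < m k)%N. Proof. exact: ltnW. Qed.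

Definition cis (t : R) : R[i] := (cos t +i* sin t)%C.

Lemma cisMn t n : cis (t *+ n) = cis t ^+ n.
Proof.
elim: n => [|n IH]; first by rewrite /cis mulr0n cos0 sin0.
rewrite exprSr -IH mulrSr /cis cosD sinD; simpc.
by congr (_ +i* _)%C; rewrite addrC [X in X + _]mulrC.
Qed.

Lemma normc_cis t : cmod (cis t) = 1.
Proof. by rewrite /cis /= cos2Dsin2 sqrtr1. Qed.

(** cos (2t) = 1 would give cos^2 t = 1, hence sin t = 0, which fails strictly between 0 and pi. *)
Lemma cis_neq1 (t : R) : 0 < t < pi -> cis (t *+ 2) != 1.
Proof.
move=> tpi; apply/negP => /eqP[+ _]; rewrite cos_mulr2n => c1.
have := exprn_gt0 2 (sin_gt0_pi tpi); rewrite sin2cos2.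
by rewrite (_ : cos t ^+ 2 = 1) ?subrr ?ltxx //; lra.
Qed.

Definition zeta k : R[i] := cis (2 * pi / (m k)%:R).

Lemma rademacherE k (x : vilenkin m) : rademacher R k x = zeta k ^+ x k.
Proof.
rewrite -cisMn -[X in cis X]mulr_natr.
by rewrite -[LHS]/(cis (2 * pi * (x k : nat)%:R / (m k)%:R)) mulrAC.
Qed.

Lemma zeta_unity k : zeta k ^+ m k = 1.
Proof.
rewrite -cisMn -[X in cis X]mulr_natr divfK ?pnatr_eq0 -?lt0n //.
by rewrite mulr_natl /cis cos2pi sin2pi.
Qed.

Lemma zeta_neq1 k d : (0 < d < m k)%N -> zeta k ^+ d != 1.
Proof.
move=> /andP[d0 dm]; rewrite -cisMn.
have -> : (2 * pi / (m k)%:R) *+ d = (pi * (d%:R / (m k)%:R)) *+ 2 :> R.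
  by rewrite -[LHS]mulr_natr -[RHS]mulr_natl -!mulrA (mulrC _^-1).
apply: cis_neq1; rewrite mulr_gt0 ?pi_gt0 ?divr_gt0 ?ltr0n //=.
by rewrite gtr_pMr ?pi_gt0 // ltr_pdivrMr ?ltr0n // mul1r ltr_nat.
Qed.

(** A geometric sum of ratio z = zeta^d: its product with z - 1 is z^(m_k) - 1 = 0, and z <> 1. *)
Lemma sum_zeta k d : (0 < d < m k)%N ->
  \sum_(0 <= j < m k) zeta k ^+ (d * j) = 0.
Proof.
move=> dm; under eq_bigr do rewrite exprM.
have /eqP := subrX1 (zeta k ^+ d) (m k).
rewrite -exprM mulnC exprM zeta_unity expr1n subrr eq_sym mulf_eq0 subr_eq0.
by rewrite (negbTE (zeta_neq1 dm)) /= big_mkord => /eqP.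
Qed.

(** The definition of [psi] stops at i; any n with i < M_n serves as well, since the digits from n
    on vanish. *)
Lemma psi_prod n i (x : vilenkin m) : (i < vM m n)%N ->
  psi R i x = \prod_(k < n) rademacher R k x ^+ vdigit m i k.
Proof.
(* Both products are compared with the one over k < i + n. *)
move=> iM; have widen a b : (forall k, (a <= k)%N -> vdigit m i k = 0%N) ->
    \prod_(k < a) rademacher R k x ^+ vdigit m i k =
    \prod_(k < a + b) rademacher R k x ^+ vdigit m i k.
  move=> a0; rewrite big_split_ord /= [X in _ = _ * X]big1 ?mulr1 // => k _.
  by rewrite a0 ?leq_addr.
rewrite /psi (widen i n) => [|k]; last exact: vdigit_eq0.
rewrite addnC -widen // => k nk; rewrite /vdigit divn_small ?mod0n //.
by rewrite (leq_trans iM) // leq_vM.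
Qed.

Lemma psi_local n i : (i < vM m n)%N -> local n (psi R i : vilenkin m -> _).
Proof.
move=> iM x y xy; rewrite !(psi_prod _ iM); apply: eq_bigr => k _.
by rewrite !rademacherE xy.
Qed.

Lemma psi_top n s d (x : vilenkin m) : (s < vM m n)%N -> (d < m n)%N ->
  psi R (s + d * vM m n) x = psi R s x * zeta n ^+ (d * x n).
Proof.
move=> sM dm; rewrite (@psi_prod n.+1) => [|/=]; last first.
  apply: (@leq_trans (d.+1 * vM m n)); first by rewrite mulSn ltn_add2r.
  by rewrite leq_mul2r dm orbT.
rewrite big_ord_recr /= vdigitD_top // rademacherE -exprM [(x n * d)%N]mulnC.
rewrite (psi_prod x sM); congr (_ * _).
by apply: eq_bigr => k _; rewrite vdigitD_low.
Qed.

Lemma psi_bottom t j (x : vilenkin m) : (j < m 0)%N ->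
  psi R (t * m 0 + j) x = psi R (t * m 0) x * zeta 0 ^+ (x 0%N * j).
Proof.
move=> jm; set n := (t * m 0 + j)%N.
have nM : (n < vM m n.+1)%N by apply: (@leq_ltn_trans n.+1) => //; exact: vM_gt.
have tM : (t * m 0 < vM m n.+1)%N by apply: leq_ltn_trans nM; exact: leq_addr.
rewrite (psi_prod x nM) (psi_prod x tM) !big_ord_recl /=.
rewrite /vdigit /= !divn1 modnMDl modnMl expr0 mul1r modn_small // mulrC.
rewrite rademacherE -exprM; congr (_ * _).
apply: eq_bigr => k _; congr (_ ^+ (_ %% _)).
(* Every M_k with k >= 1 is a multiple of m_0, so adding j < m_0 to a multiple of m_0 leaves the
   digits of positive index alone. *)
have /dvdnP[q] := @vM_dvd m 1 (bump 0 k) isT; rewrite /= muln1 => ->.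
by rewrite [(q * _)%N]mulnC !divnMA divnMDl // (divn_small jm) addn0 mulnK.
Qed.

Lemma psi_vI n i (x : vilenkin m) : (i < vM m n)%N -> 
  (forall k, (k < n)%N -> x k = 0) -> psi R i x = 1.
Proof.
move=> iM x0; rewrite (psi_prod x iM) big1 // => k _.
by rewrite rademacherE x0 // expr0 expr1n.
Qed.

Lemma normcX (z : R[i]) n : cmod (z ^+ n) = cmod z ^+ n.
Proof.
by elim: n => [|n IH]; rewrite ?ComplexField.Normc.normc1 // !exprS
  ComplexField.Normc.normcM IH.
Qed.

Lemma normc_psi i (x : vilenkin m) : cmod (psi R i x) = 1.
Proof.
rewrite /psi; elim/big_rec: _ => [|k z _ zE].
  exact: ComplexField.Normc.normc1.
rewrite ComplexField.Normc.normcM zE mulr1 normcX rademacherE normcX.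
by rewrite normc_cis !expr1n.
Qed.

End characters.

(** * Martingales with constant coefficients on each level *)

Section martingale.
Variables (R : realType) (m : nat -> nat).
Hypothesis m2 : forall k, (1 < m k)%N.
Variable mu : probability (vilenkin m) R.
Hypothesis mu_haar : product_uniform mu.

Let m_gt0 k : (0 < m k)%N. Proof. exact: ltnW. Qed.

Local Notation cint := (cintegral mu setT).

Lemma cint_lin n c (g h : vilenkin m -> R[i]) : local n g -> local n h ->
  cint (fun x => g x + c * h x) = cint g + c * cint h.
Proof.
move=> lg lh; rewrite !(@local_cintegral _ _ _ _ _ n) //; last first.
  by move=> x y xy; rewrite (lg _ _ xy) (lh _ _ xy).
by rewrite /mean big_split /= mulrDr -mulr_sumr mulrCA.
Qed.

Lemma cint_sum K n (c : nat -> R[i]) (g : nat -> vilenkin m -> R[i]) :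
  (forall j, (j < n)%N -> local K (g j)) ->
  cint (fun x => \sum_(j < n) c j * g j x) = \sum_(j < n) c j * cint (g j).
Proof.
elim: n => [_|n IH lg].
  rewrite big_ord0 (@local_cintegral _ _ _ _ _ 0) //; last first.
    by move=> x y _; rewrite !big_ord0.
  by rewrite /mean big1 ?mulr0 // => s _; rewrite big_ord0.
have lg' j : (j < n)%N -> local K (g j) by move=> jn; apply: lg; exact: ltnW.
rewrite big_ord_recr /= -IH // -(@cint_lin K); last 2 first.
- by move=> x y xy; apply: eq_bigr => j _; rewrite (lg' _ (ltn_ord j) _ _ xy).
- exact: lg.
by congr cintegral; apply/funext => x; rewrite big_ord_recr.
Qed.

(** Independence again, for integrals: the orthogonality relations below reduce to averages over the
    values of one coordinate. *)
Lemma cint_coord n (g h : vilenkin m -> R[i]) (c : nat -> R[i]) :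
  local n h -> (forall x, g x = h x * c (x n)) ->
  cint g = cint h * ((m n)%:R^-1 * \sum_(0 <= d < m n) c d).
Proof.
move=> lh gE; have -> : g = fun x => h x * c (x n) by exact/funext.
rewrite (@local_cintegral _ _ _ _ _ n.+1) //; last first.
  by move=> x y xy; rewrite (local_le (leqnSn n) lh xy) xy.
by rewrite mean_coord // (@local_cintegral _ _ _ _ _ n).
Qed.

(** * Dirichlet kernels and their increments *)

Definition origin : vilenkin m := fun=> 0.

Definition dirichlet n (x : vilenkin m) : R :=
  (vM m n)%:R * \1_(vI n origin) x.

Definition mdiff n (x : vilenkin m) : R := dirichlet n.+1 x - dirichlet n x.

(** The ratio (D_(n+1) - D_n) / D_n on I_n(0), as a function of the digit x_n. *)
Definition jump n (d : nat) : R := (m n)%:R * (d == 0%N)%:R - 1.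

Lemma dirichlet_local n : local n (dirichlet n).
Proof.
by move=> x y xy; rewrite /dirichlet (local_indic R (@vI_local m n origin) xy).
Qed.

Lemma dirichletS n x : dirichlet n.+1 x =
  dirichlet n x * ((m n)%:R * ((x n : nat) == 0%N)%:R).
Proof.
rewrite /dirichlet natrM !indicE mulrACA [(m n)%:R * _]mulrC; congr (_ * _).
rewrite -natrM mulnb; congr (nat_of_bool _)%:R.
apply/idP/andP; rewrite !inE /vI /=.
  move=> h; split; first by rewrite ?inE => k kn; apply: h; exact: ltnW.
  by rewrite h.
rewrite ?inE => -[h /eqP xn] k; rewrite ltnS leq_eqVlt => /predU1P[->|/h//].
exact: ord_inj.
Qed.

Lemma mdiffE n x : mdiff n x = dirichlet n x * jump n (x n).
Proof. by rewrite /mdiff dirichletS /jump mulrBr mulr1. Qed.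

Lemma mdiff_local n : local n.+1 (mdiff n).
Proof.
move=> x y xy; rewrite /mdiff (dirichlet_local xy).
by rewrite (local_le (leqnSn n) (@dirichlet_local n) xy).
Qed.

Lemma sum_pick0 n (F : nat -> R[i]) :
  \sum_(0 <= d < m n) (d == 0%N)%:R * F d = F 0%N.
Proof.
rewrite big_ltn // mul1r big_nat big1 ?addr0 // => d /andP[d0 _].
by rewrite (gtn_eqF d0) mul0r.
Qed.

Lemma jump_avg n (z : nat -> R[i]) :
  (m n)%:R^-1 * \sum_(0 <= d < m n) (jump n d)%:C%C * z d =
  z 0%N - (m n)%:R^-1 * \sum_(0 <= d < m n) z d.
Proof.
under eq_bigr do rewrite /jump rmorphB rmorphM /= rmorph1 mulrBl mul1r.
rewrite sumrB mulrBr; congr (_ - _).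
under eq_bigr do rewrite !rmorph_nat -mulrA.
by rewrite -mulr_sumr sum_pick0 mulKf // pnatr_eq0 -lt0n.
Qed.

(** Given the first n coordinates, the increment of D averages to zero over x_n: this is the source
    of the martingale property. *)
Lemma jump_avg1 n :
  (m n)%:R^-1 * \sum_(0 <= d < m n) (jump n d)%:C%C = 0 :> R[i].
Proof.
have := jump_avg n (fun=> 1); under eq_bigr do rewrite mulr1.
move=> ->; rewrite sumr_const_nat subn0 -[1 *+ _]/((m n)%:R).
by rewrite mulVf ?subrr // pnatr_eq0 -lt0n.
Qed.

Lemma cint_dirichlet n : cint (fun x => (dirichlet n x)%:C%C) = 1.
Proof.
elim: n => [|n IH].
  rewrite (@local_cintegral _ _ _ _ _ 0) //; last first.
    by move=> x y xy; rewrite (dirichlet_local xy).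
  rewrite /mean /= big_nat1 invr1 mul1r /dirichlet mul1r indicE mem_set //.
rewrite (@cint_coord n _ (fun x => (dirichlet n x)%:C%C)
    (fun d => (m n)%:R * (d == 0%N)%:R)) => [|x y xy|x]; last 2 first.
- by rewrite (dirichlet_local xy).
- by rewrite dirichletS !rmorphM /= !rmorph_nat.
rewrite IH mul1r -mulr_sumr mulKf; last by rewrite pnatr_eq0 -lt0n.
have := sum_pick0 n (fun=> 1).
by under eq_bigr do rewrite mulr1.
Qed.

Lemma cint_mdiff_local n (h : vilenkin m -> R[i]) : local n h ->
  cint (fun x => (mdiff n x)%:C%C * h x) = 0.
Proof.
move=> lh; rewrite (@cint_coord n _ (fun x => (dirichlet n x)%:C%C * h x)
    (fun d => (jump n d)%:C%C)) => [|x y xy|x].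
- by rewrite jump_avg1 mulr0.
- by rewrite (dirichlet_local xy) (lh _ _ xy).
- by rewrite mdiffE rmorphM mulrAC.
Qed.

Lemma conjcM (y z : R[i]) : ((y * z)^*)%C = (y^*)%C * (z^*)%C.
Proof. exact: (rmorphM conjc). Qed.

Lemma sum_zeta_conj k d : (0 < d < m k)%N ->
  \sum_(0 <= j < m k) ((zeta R m k ^+ (d * j))^*)%C = 0.
Proof.
by move=> dm; rewrite -(rmorph_sum conjc) /= sum_zeta // rmorph0.
Qed.

(** The position of i relative to the block [M_n, M_(n+1)[ decides which coordinate is averaged
    first. *)
Lemma cint_mdiff_psi n i :
  cint (fun x => (mdiff n x)%:C%C * ((psi R i x)^*)%C) =
  (vM m n <= i < vM m n.+1)%N%:R.
Proof.
case: (ltnP i (vM m n)) => [iM|iM] /=.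
  (* Before the block, psi_i depends on the first n coordinates only. *)
  apply: cint_mdiff_local => x y xy; congr (conjc _).
  exact: (psi_local R m2 iM).
have i0 : (0 < i)%N by apply: leq_trans iM; exact: vM_gt0.
have [q /andP[q1 q2]] := level_exists m2 i0.
have [s [d [iE sM dm]]] := vM_split m2 q2.
have d0 : (0 < d)%N.
  rewrite lt0n; apply/eqP => d0; move: q1.
  by rewrite iE d0 addn0 leqNgt sM.
have psiE (x : vilenkin m) : ((psi R i x)^*)%C =
    ((psi R s x)^*)%C * (fun j => ((zeta R m q ^+ (d * j))^*)%C) (x q).
  by rewrite {1}iE (psi_top R m2) // conjcM.
have dd : (0 < d < m q)%N by rewrite d0 dm.
have psis : local q (fun x : vilenkin m => ((psi R s x)^*)%C).
  by move=> x y xy; rewrite (psi_local R m2 sM xy).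
case: (ltnP i (vM m n.+1)) => iM'.
  have nq : n = q by apply: (level_uniq m2 (i := i)); apply/andP; split.
  subst q.
  (* In the block, psi_s = 1 on the support I_n(0) of D_n, so only the top digit d of i is left; its
     character equals 1 at 0 and averages to 0. *)
  rewrite (@cint_coord n _ (fun x => (dirichlet n x)%:C%C) (fun j =>
     (jump n j)%:C%C * ((zeta R m n ^+ (d * j))^*)%C)) => [|x y xy|x];
    last 2 first.
  - by rewrite (dirichlet_local xy).
  - rewrite psiE mdiffE rmorphM /= /dirichlet indicE.
    have [|_] := boolP (x \in _); last by rewrite mulr0 !mul0r.
    by rewrite inE => xI; rewrite (psi_vI R m2 sM) ?conjc1 ?mul1r ?mulrA.
  rewrite cint_dirichlet mul1r.
  rewrite (jump_avg n (fun j => ((zeta R m n ^+ (d * j))^*)%C)).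
  by rewrite sum_zeta_conj // mulr0 subr0 muln0 expr0 conjc1.
have nq : (n < q)%N.
  rewrite ltnNge; apply/negP => qn.
  have := leq_trans (leq_vM m2 (qn : (q.+1 <= n.+1)%N)) iM'.
  by rewrite leqNgt q2.
(* After the block, the increment depends only on coordinates below q, while the top digit of i
   contributes a nontrivial character of x_q. *)
rewrite (@cint_coord q _ (fun x => (mdiff n x)%:C%C * ((psi R s x)^*)%C)
    (fun j => ((zeta R m q ^+ (d * j))^*)%C)) => [|x y xy|x].
- by rewrite sum_zeta_conj // !mulr0.
- by rewrite (psis _ _ xy) (local_le nq (@mdiff_local n) xy).
- by rewrite psiE mulrA.
Qed.

(** * The martingale with coefficient b_k on the k-th block, and its Fourier coefficients *)

Variable b : nat -> R.

Definition vmart n (x : vilenkin m) : R[i] :=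
  (\sum_(k < n) b k * mdiff k x)%:C%C.

(** At most one term is nonzero, that of the level n of i; index 0 has no level. The range k <= i
    suffices, because n < M_n <= i. *)
Definition vcoef i : R :=
  \sum_(k < i.+1) b k * (vM m k <= i < vM m k.+1)%N%:R.

Lemma vmartE n x : vmart n x = \sum_(k < n) (b k)%:C%C * (mdiff k x)%:C%C.
Proof.
by rewrite /vmart rmorph_sum; apply: eq_bigr => k _; rewrite rmorphM.
Qed.

Lemma vmart_local n : local n (vmart n).
Proof.
move=> x y xy; rewrite !vmartE; apply: eq_bigr => k _.
by rewrite (local_le (ltn_ord k) (@mdiff_local k) xy).
Qed.

Lemma vcoef_level n i : (vM m n <= i < vM m n.+1)%N -> vcoef i = b n.
Proof.
move=> iM; have ni : (n < i.+1)%N.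
  by case/andP: iM => h _; rewrite ltnS ltnW // (leq_trans _ h) ?vM_gt.
rewrite /vcoef (bigD1 (Ordinal ni)) //= iM mulr1 big1 ?addr0 // => k kn.
have [kM|_] := boolP (vM m k <= i < vM m k.+1)%N; last by rewrite mulr0.
by case/negP: kn; apply/eqP/ord_inj/(level_uniq m2 kM).
Qed.

Lemma vcoef0 : vcoef 0 = 0.
Proof. by rewrite /vcoef big1 // => k _; rewrite leqNgt vM_gt0 ?mulr0. Qed.

Lemma cint_vmart_psi k i :
  cint (fun x => vmart k x * ((psi R i x)^*)%C) =
  (\sum_(j < k) b j * (vM m j <= i < vM m j.+1)%N%:R)%:C%C.
Proof.
have -> : (fun x => vmart k x * ((psi R i x)^*)%C) = fun x =>
    \sum_(j < k) (b j)%:C%C * ((mdiff j x)%:C%C * ((psi R i x)^*)%C).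
  apply/funext => x; rewrite vmartE mulr_suml.
  by apply: eq_bigr => j _; rewrite mulrA.
(* At level [maxn k i] both psi_i and the increments of index j < k are local. *)
rewrite (@cint_sum (maxn k i) k (fun j => (b j)%:C%C)
    (fun j x => (mdiff j x)%:C%C * ((psi R i x)^*)%C)) => [|j jk x y xy].
  rewrite rmorph_sum; apply: eq_bigr => j _.
  by rewrite cint_mdiff_psi rmorphM rmorph_nat.
have jle : (j.+1 <= maxn k i)%N by rewrite leq_max jk.
rewrite (local_le jle (@mdiff_local j) xy).
by rewrite (local_le (leq_maxr k i) (psi_local R m2 (vM_gt m2 i)) xy).
Qed.

(** The integrals in the definition of the coefficient stop changing once k > i, since i < M_j for j
    > i. *)
Lemma fcoef_vmart i : fcoef mu vmart i = (vcoef i)%:C%C.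
Proof.
have E k : (i < k)%N ->
    cint (fun x => vmart k x * ((psi R i x)^*)%C) = (vcoef i)%:C%C.
  move=> ik; rewrite cint_vmart_psi; congr (_%:C)%C.
  pose F j := b j * (vM m j <= i < vM m j.+1)%N%:R.
  rewrite -[LHS](big_mkord xpredT F) -[RHS](big_mkord xpredT F).
  rewrite (big_cat_nat (n := i.+1)) //= [X in _ + X](_ : _ = 0) ?addr0 //.
  rewrite big_nat big1 // => j /andP[ij _]; rewrite /F leqNgt.
  by rewrite (leq_trans ij (ltnW (vM_gt m2 j))) mulr0.
rewrite /fcoef /clim; congr (_ +i* _)%C; apply/cvg_lim => //;
  apply: cvg_near_cst; exists i.+1 => // k ik.
  exact: (congr1 (@complex.Re R) (E k ik)).
exact: (congr1 (@complex.Im R) (E k ik)).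
Qed.

(** By induction on l - n: the indicator of A is local at every level q >= n, so the increment of
    index q integrates to 0 over A. *)
Lemma vmart_cond_exp n l (A : set (vilenkin m)) : (n <= l)%N ->
  <<s vcells m n >> A -> cintegral mu A (vmart n) = cintegral mu A (vmart l).
Proof.
move=> nl /Fset_local lA; rewrite -(subnKC nl).
elim: (l - n)%N => [|k IH]; first by rewrite addn0.
rewrite addnS {}IH !(cintegral_restrict mu A).
set q := (n + k)%N.
have lA' : local q (fun x => (\1_A x)%:C%C : R[i]).
  move=> x y xy.
  by rewrite (local_indic R (local_le (leq_addr k n) lA) xy).
have -> : (fun x => (\1_A x)%:C%C * vmart q.+1 x) = fun x =>
    (\1_A x)%:C%C * vmart q x + (b q)%:C%C * ((mdiff q x)%:C%C * (\1_A x)%:C%C).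
  apply/funext => x; rewrite !vmartE big_ord_recr mulrDr; congr (_ + _).
  by rewrite mulrC mulrA.
rewrite (@cint_lin q.+1).
- by rewrite cint_mdiff_local // mulr0 addr0.
- move=> x y xy; rewrite (local_le (leqnSn q) lA' xy).
  by rewrite (local_le (leqnSn q) (@vmart_local q) xy).
- move=> x y xy; rewrite (local_le (leqnSn q) lA' xy).
  by rewrite (mdiff_local xy).
Qed.

Lemma vmart_martingale : martingale mu vmart.
Proof.
have lv n := @vmart_local n.
split=> [n|n l nl].
  by split; [exact: (local_cintegrable m2 mu (lv n))|
             exact: (local_Fmeasurable m2 (lv n))].
split; first exact: (local_Fmeasurable m2 (lv n)).
  exact: (local_cintegrable m2 mu (lv n)).
by move=> A nA; exact: vmart_cond_exp.
Qed.

End martingale.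

(** * The Hardy norm *)

Section hardy_bound.
Variables (R : realType) (m : nat -> nat).
Hypothesis m2 : forall k, (1 < m k)%N.
Variable mu : probability (vilenkin m) R.
Hypothesis mu_haar : product_uniform mu.
Variables (p : R) (C : nat) (v : nat -> R).
Hypotheses (p_gt0 : 0 < p) (mC : forall k, (m k <= C)%N).
Hypotheses (v_ge0 : forall k, 0 <= v k).
Hypothesis v_sum : forall n, \sum_(0 <= k < n) v k <= 2.

(* The exponent 1 + p^-1 of v is what makes the summability of v alone
   sufficient for the Hardy norm, for every p. *)
Definition weight k : R :=
  v k * v k `^ p^-1 * (vM m k)%:R `^ (p^-1 - 1).

Let mass k (x : vilenkin m) : R := v k * dirichlet R k x.

Let H (x : vilenkin m) : \bar R := (\sum_(0 <= k <oo) (mass k x)%:E)%E.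

Let vM_gt0r k : 0 < (vM m k)%:R :> R. Proof. by rewrite ltr0n vM_gt0. Qed.

Let pV_gt0 : 0 < p^-1. Proof. by rewrite invr_gt0. Qed.

Lemma dirichlet_ge0 k (x : vilenkin m) : 0 <= dirichlet R k x.
Proof. by rewrite /dirichlet mulr_ge0 // indicE. Qed.

Let mass_ge0 k x : 0 <= mass k x.
Proof. by rewrite /mass mulr_ge0 // dirichlet_ge0. Qed.

Let H_ge0 x : (0 <= H x)%E.
Proof. by apply: nneseries_ge0 => k _ _; rewrite lee_fin. Qed.

Lemma weight_ge0 k : 0 <= weight k.
Proof. by rewrite /weight !mulr_ge0 // powR_ge0. Qed.

(** Here the boundedness of m enters: replacing D_(k+1) - D_k by D_k costs at most a factor C. *)
Lemma normr_jump k (d : nat) : `|jump R m k d| <= C%:R.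
Proof.
have h : 1 <= (m k)%:R :> R by rewrite ler1n ltnW.
apply: (@le_trans _ _ (m k)%:R); last by rewrite ler_nat.
rewrite /jump; case: (d == 0%N) => /=; rewrite ?mulr1 ?mulr0.
  by rewrite ger0_norm ?subr_ge0 // lerBlDr lerDl.
by rewrite sub0r normrN1.
Qed.

(** D_k takes only the values 0 and M_k, hence M_k^(1/p - 1) D_k = D_k^(1/p). *)
Let weight_dirichlet k x :
  weight k * dirichlet R k x = v k * mass k x `^ p^-1.
Proof.
rewrite /weight /mass /dirichlet indicE.
case: (x \in _) => /=; rewrite ?mulr0 ?mulr1; last first.
  by rewrite powR0 ?mulr0 // gt_eqF.
rewrite powRM // -!mulrA; congr (_ * (_ * _)).
rewrite -{2}[(vM m k)%:R]powRr1 // -powRD ?subrK //.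
by rewrite gt_eqF ?implybT.
Qed.

Let sum_mass_ge0 n x : 0 <= \sum_(k < n) mass k x.
Proof. by apply: sumr_ge0 => k _. Qed.

(** Each [mass k] is at most the whole sum S, so the k-th term is at most C v_k S^(1/p), and the v_k
    add up to at most 2. *)
Lemma normr_martingale n (x : vilenkin m) :
  `|\sum_(k < n) weight k * mdiff R k x| <=
  2 * C%:R * (\sum_(k < n) v k * dirichlet R k x) `^ p^-1.
Proof.
apply: le_trans (ler_norm_sum _ _ _) _.
set S := \sum_(k < n) v k * _.
have term (k : 'I_n) :
    `|weight k * mdiff R k x| <= v k * (C%:R * S `^ p^-1).
  rewrite mdiffE mulrA weight_dirichlet normrM ger0_norm; last first.
    by rewrite mulr_ge0 // powR_ge0.
  rewrite -mulrA; apply: ler_wpM2l => //; rewrite mulrC.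
  apply: ler_pM; rewrite ?powR_ge0 ?normr_jump //.
  apply: ge0_ler_powR; [exact: ltW|exact: mass_ge0|exact: sum_mass_ge0|].
  rewrite /S (bigD1 k) //= lerDl sumr_ge0 // => i _; exact: mass_ge0.
apply: le_trans (ler_sum _ (fun k _ => term k)) _.
rewrite -mulr_suml -mulrA; apply: ler_wpM2r.
  by rewrite mulr_ge0 // powR_ge0.
by rewrite -(big_mkord xpredT v).
Qed.

Let maximal_le (x : vilenkin m) :
  (maximal (vmart (m := m) weight) x <= (2 * C%:R)%:E * H x `^ p^-1)%E.
Proof.
apply: ge_ereal_sup => _ [n _ <-].
rewrite /vmart /= expr0n addr0 sqrtr_sqr.
apply: (@le_trans _ _ ((2 * C%:R) *
    (\sum_(k < n) v k * dirichlet R k x) `^ p^-1)%:E).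
  by rewrite lee_fin normr_martingale.
rewrite EFinM; apply: lee_wpmul2l; first by rewrite lee_fin mulr_ge0.
rewrite -poweR_EFin; apply: gt0_ler_poweR.
- exact: ltW.
- by rewrite in_itv /= lee_fin sum_mass_ge0 leey.
- by rewrite in_itv /= H_ge0 leey.
rewrite -sumEFin -(big_mkord xpredT (fun k => (mass k x)%:E)).
by apply: nneseries_lim_ge => k _ _; rewrite lee_fin.
Qed.

Let maximal_ge0 (x : vilenkin m) :
  (0 <= maximal (vmart (m := m) weight) x)%E.
Proof.
apply: (@le_trans _ _ (cmod (vmart weight 0 x))%:E).
  by rewrite lee_fin /vmart /= sqrtr_ge0.
by apply: ereal_sup_ubound; exists 0%N.
Qed.

Let measurable_maximal :
  measurable_fun (setT : set (vilenkin m))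
    (fun x => maximal (vmart (m := m) weight) x).
Proof.
have mE n : measurable_fun (setT : set (vilenkin m))
    (fun x => (cmod (vmart weight n x))%:E).
  apply: (@local_measurable_fun _ m2 n) => x y xy.
  by rewrite (vmart_local weight xy).
(* [maximal] is the tail supremum of index 0 of a sequence of measurable functions. *)
have := @measurable_fun_esups _ _ _ setT _ mE 0%N.
congr measurable_fun; apply/funext => x; congr (ereal_sup _).
by apply/seteqP; split => _ [n _ <-]; exists n.
Qed.

Let measurable_mass k : measurable_fun setT (EFin \o mass k).
Proof.
apply: (@local_measurable_fun _ m2 k) => x y xy.
by rewrite /= /mass (dirichlet_local R xy).
Qed.

Let measurable_H : measurable_fun (setT : set (vilenkin m)) H.
Proof.
have := @ge0_emeasurable_sum _ (vilenkin m) R setT (fun k x => (mass k x)%:E)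
  xpredT; apply => [k x _ _|k _]; last exact: measurable_mass.
by rewrite lee_fin.
Qed.

Let integral_mass k : (\int[mu]_x (mass k x)%:E = (v k)%:E)%E.
Proof.
rewrite /mass /dirichlet.
under eq_integral do rewrite mulrA EFinM.
have mI : measurable_fun setT (fun x => (\1_(vI k (origin m)) x)%:E : \bar R).
  apply: (@local_measurable_fun _ m2 k) => x y xy.
  by rewrite (local_indic R (@vI_local m k (origin m)) xy).
rewrite ge0_integralZl_EFin ?mulr_ge0 //.
rewrite integral_indic //; last exact: measurable_vI.
transitivity ((v k * (vM m k)%:R)%:E * ((vM m k)%:R^-1)%:E)%E.
  by rewrite setIT; congr (_ * _)%E; exact: mu_vI.
by rewrite -EFinM mulfK // gt_eqF.
Qed.

Let integral_H : (\int[mu]_x H x <= 2%:E)%E.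
Proof.
rewrite integral_nneseries //; last by move=> k x _; rewrite lee_fin.
rewrite (eq_eseriesr (fun k _ => integral_mass k)).
apply: lime_le.
  by apply: is_cvg_nneseries => k _ _; rewrite lee_fin.
by apply: nearW => n; rewrite sumEFin lee_fin.
Qed.

Lemma vmart_hardy : hardy mu p (vmart weight).
Proof.
split; first exact: vmart_martingale.
rewrite unlock; apply: poweR_lty.
apply: (@le_lt_trans _ _ (\int[mu]_x (((2 * C%:R) `^ p)%:E * H x))%E).
  apply: ge0_le_integral => //.
  - by move=> x _; exact: poweR_ge0.
  - apply: (measurableT_comp (measurable_poweR p)).
    exact: measurableT_comp.
  - exact: emeasurable_funM.
  - move=> x _; rewrite gee0_abs //.
    have -> : (((2 * C%:R) `^ p)%:E * H x)%E =
        (((2 * C%:R)%:E * H x `^ p^-1) `^ p)%E.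
      rewrite poweRM ?poweR_ge0 ?lee_fin ?mulr_ge0 // -poweRrM mulVf ?gt_eqF //.
      by rewrite poweRe1.
    apply: gt0_ler_poweR; rewrite ?in_itv /= ?maximal_ge0 ?leey ?(ltW p_gt0) //.
    by rewrite andbT mule_ge0 ?poweR_ge0 // lee_fin mulr_ge0.
rewrite ge0_integralZl_EFin ?powR_ge0 //.
apply: (@le_lt_trans _ _ (((2 * C%:R) `^ p)%:E * 2%:E)%E).
  by apply: lee_wpmul2l; rewrite ?lee_fin ?powR_ge0.
by rewrite -EFinM ltry.
Qed.

End hardy_bound.

(** * Divergence of the series *)

(** With terms that are nonnegative, a block of sum at least A keeps all partial sums that contain
    it above A. *)
Lemma series_pinftyI (R : realType) (u : nat -> \bar R) :
  (forall k, (0 < k)%N -> (0 <= u k)%E) ->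
  (forall A : R, exists a b, [/\ (0 < a)%N, (a <= b)%N &
     (A%:E <= \sum_(a <= k < b) u k)%E]) ->
  series_pinfty u.
Proof.
move=> u0 uA; apply/cvgeyPge => A; have [a [b [a0 ab Ab]]] := uA A.
exists b => // n /= bn; apply: le_trans Ab _.
have bn1 : (b <= n.+1)%N by exact: leqW.
rewrite [leRHS](big_cat_nat a0 (leq_trans ab bn1)) /=.
rewrite [X in (_ <= _ + X)%E](big_cat_nat ab bn1) /=.
have nonneg c d : (0 < c)%N -> (0 <= \sum_(c <= k < d) u k)%E.
  move=> c0; rewrite big_nat; apply: sume_ge0 => k /andP[ck _].
  by apply: u0; exact: leq_trans c0 ck.
rewrite addeC -addeA leeDl // adde_ge0 ?nonneg //.
exact: leq_trans a0 ab.
Qed.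

Section series.
Variables (R : realType) (m : nat -> nat).
Hypothesis m2 : forall k, (1 < m k)%N.
Variable mu : probability (vilenkin m) R.
Hypothesis mu_haar : product_uniform mu.
Variables (p : R) (v : nat -> R) (Phi : nat -> R).
Hypotheses (p_gt0 : 0 < p) (p_le2 : p <= 2).
Hypotheses (v_ge0 : forall k, 0 <= v k) (v_le1 : forall k, v k <= 1).
Hypothesis v0 : v 0 = 0.
Hypothesis Phi_nd : forall i j, (1 <= i)%N -> (i <= j)%N -> Phi i <= Phi j.
Hypothesis Phi_v : forall k, v k != 0 -> 0 <= Phi (vM m k).

Let w k := v k * v k `^ p^-1.
Hypothesis Phi_w : forall A : R, exists k, A <= Phi (vM m k) * w k ^+ 2.

Local Notation b := (weight m p v).
Local Notation f := (vmart (m := m) b).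

Let m_gt0 k : (0 < m k)%N. Proof. exact: ltnW. Qed.

Let vM_gt0r k : 0 < (vM m k)%:R :> R. Proof. by rewrite ltr0n vM_gt0. Qed.

Let w_ge0 k : 0 <= w k. Proof. by rewrite /w mulr_ge0 // powR_ge0. Qed.

Let w_le1 k : w k <= 1.
Proof.
rewrite /w mulr_ile1 ?powR_ge0 //.
have -> : 1 = 1 `^ p^-1 :> R by rewrite powR1.
apply: ge0_ler_powR; rewrite ?nnegrE //.
by rewrite invr_ge0 ltW.
Qed.

Let b_ge0 k : 0 <= b k. Proof. exact: weight_ge0. Qed.

Let b_eq0 k : v k = 0 -> b k = 0.
Proof. by move=> vk; rewrite /weight vk !mul0r. Qed.

Let Phi_b k : b k != 0 -> 0 <= Phi (vM m k).
Proof. by move=> bk; apply: Phi_v; apply: contraNneq bk => /b_eq0 ->. Qed.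

Let Phi_w_big (A : R) : 0 < A ->
  exists k, [/\ (0 < k)%N, 0 < b k, 0 <= Phi (vM m k) &
    A <= Phi (vM m k) * w k ^+ 2].
Proof.
move=> A0; have [k Ak] := Phi_w A; exists k.
(* A positive lower bound rules out v_k = 0, and with it k = 0. *)
have vk : v k != 0.
  apply: contraTneq A0 => vk; rewrite -leNgt (le_trans Ak) //.
  by rewrite /w vk mul0r expr0n mulr0.
have vk0 : 0 < v k by rewrite lt0r vk v_ge0.
split=> //; last exact: Phi_v.
  by rewrite lt0n; apply: contraNneq vk => ->; rewrite v0.
by rewrite /weight !mulr_gt0 // powR_gt0.
Qed.

(** Phi may be negative at first, but then no level reached so far carries a nonzero coefficient;
    this keeps the terms of the first and third series nonnegative. *)
Let Phi_vcoef k : 0 <= Phi k \/ (forall i, (i <= k)%N -> vcoef m b i = 0).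
Proof.
have [|Phik] := leP 0 (Phi k); [by left|right => i ik].
have [->|i0] := posnP i; first exact: vcoef0.
have [n iM] := level_exists m2 i0; rewrite (vcoef_level m2 _ iM).
have [//|/eqP/Phi_b Phin] := pselect (b n = 0).
move: Phik; rewrite ltNge (le_trans Phin) //; apply: Phi_nd.
  exact: vM_gt0.
by case/andP: iM => ni _; exact: leq_trans ik.
Qed.

Let normc_fcoef i : cmod (fcoef mu f i) = vcoef m b i.
Proof.
rewrite fcoef_vmart //= expr0n addr0 sqrtr_sqr ger0_norm //.
by apply: sumr_ge0 => k _; rewrite mulr_ge0.
Qed.

Let vcoef_first n k : (vM m n <= k < 2 * vM m n)%N -> vcoef m b k = b n.
Proof.
move=> /andP[k1 k2]; apply: (vcoef_level m2); rewrite k1 /=.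
by apply: leq_trans k2 _; rewrite leq_mul2r m2 orbT.
Qed.

(** When Phi (M_n) >= 0, a common lower bound for the terms of the first series with M_n <= k < 2
    M_n: Phi is taken at M_n and the denominator at 2 M_n. *)
Let block_const n := b n `^ p * Phi (vM m n) / (2 * (vM m n)%:R) `^ (2 - p).

Let block_const_le n k : 0 <= Phi (vM m n) -> (vM m n <= k < 2 * vM m n)%N ->
  block_const n <= b n `^ p * (Phi k / k%:R `^ (2 - p)).
Proof.
move=> Phin /andP[k1 k2]; rewrite /block_const -mulrA.
apply: ler_wpM2l; first exact: powR_ge0.
have k0 : (0 < k)%N by apply: leq_trans k1; exact: vM_gt0.
apply: ler_pM => //.
- by apply: Phi_nd => //; exact: vM_gt0.
- rewrite lef_pV2 ?posrE ?powR_gt0 ?mulr_gt0 ?ltr0n ?vM_gt0 //.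
  apply: ge0_ler_powR; rewrite ?nnegrE ?subr_ge0 ?mulr_ge0 //.
  by rewrite -natrM ler_nat ltnW.
Qed.

(** M_n b_n^p = w_n^p M_n^(2 - p), so the powers of M_n cancel against the denominator; the 4 bounds
    2^(2 - p). *)
Let block_const_ge n : 0 <= Phi (vM m n) ->
  Phi (vM m n) * w n ^+ 2 / 4 <= (vM m n)%:R * block_const n.
Proof.
move=> Phin; set M := (vM m n)%:R : R.
have M0 : 0 < M := vM_gt0r n.
have bE : b n `^ p = w n `^ p * M `^ (1 - p).
  rewrite /weight -/(w n) powRM ?powR_ge0 // -powRrM mulrBl mul1r.
  by rewrite mulVf ?gt_eqF.
have ME : M * M `^ (1 - p) = M `^ (2 - p).
  rewrite -{1}[M]powRr1 ?ltW // -powRD; last by rewrite (gt_eqF M0) implybT.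
  by congr (_ `^ _); ring.
have -> : M * block_const n = Phi (vM m n) * (w n `^ p / 2 `^ (2 - p)).
  rewrite /block_const bE powRM ?ltW // -ME.
  have h1 : M != 0 by rewrite gt_eqF.
  have h2 : M `^ (1 - p) != 0 by rewrite gt_eqF ?powR_gt0.
  have h3 : 2 `^ (2 - p) != 0 :> R by rewrite gt_eqF ?powR_gt0.
  by field; rewrite h1 h2 h3.
rewrite -mulrA; apply: ler_wpM2l => //; apply: ler_pM.
- exact: exprn_ge0.
- by rewrite invr_ge0.
- have [->|wn] := eqVneq (w n) 0; first by rewrite expr0n powR_ge0.
  have wn0 : 0 < w n by rewrite lt0r wn w_ge0.
  by rewrite -powR_mulrn //; apply: ger_powR; rewrite ?wn0 ?w_le1.
- rewrite lef_pV2 ?posrE ?powR_gt0 //.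
  apply: (@le_trans _ _ (2 `^ 2%:R)); last by rewrite powR_mulrn // -natrX.
  by apply: ler_powR; rewrite ?ler1n // gerBl ltW.
Qed.

(** * The two series of Fourier coefficients *)

Lemma fcoef_series : series_pinfty (fun k =>
  (cmod (fcoef mu f k) `^ p * Phi k / k%:R `^ (2 - p))%:E).
Proof.
apply: series_pinftyI => [k k0|A].
  rewrite lee_fin normc_fcoef; have [Phik|->//] := Phi_vcoef k.
    by rewrite divr_ge0 ?mulr_ge0 ?powR_ge0.
  by rewrite powR0 ?mul0r // gt_eqF.
(* The 4 offsets the denominator in [block_const_ge]; the added 1 gives the positivity that
   [Phi_w_big] asks for. *)
have A0 : 0 < 4 * `|A| + 1 by rewrite ltr_wpDl // mulr_ge0.
have [n [n0 bn Phin An]] := Phi_w_big A0.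
exists (vM m n), (2 * vM m n)%N; split.
- exact: vM_gt0.
- by rewrite leq_pmull.
rewrite sumEFin lee_fin.
apply: (@le_trans _ _ (\sum_(vM m n <= k < 2 * vM m n) block_const n)).
  rewrite sumr_const_nat mul2n -addnn addnK -mulr_natl.
  apply: le_trans (block_const_ge Phin).
  rewrite ler_pdivlMr //; apply: le_trans An; have := ler_norm A; lra.
apply: ler_sum_nat => k kM; rewrite normc_fcoef (vcoef_first kM) -mulrA.
exact: block_const_le.
Qed.

Lemma fcoef_lacunary_series : series_pinfty (fun k =>
  (Phi (vM m k) / (vM m k)%:R `^ (2 / p - 2) *
   \sum_(1 <= j < m k) cmod (fcoef mu f (j * vM m k)%N) ^+ 2)%:E).
Proof.
have coefE k j : (0 < j < m k)%N -> cmod (fcoef mu f (j * vM m k)%N) = b k.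
  move=> /andP[j0 jm]; rewrite normc_fcoef; apply: (vcoef_level m2).
  by rewrite leq_pmull //= ltn_pmul2r ?vM_gt0.
have sumE k : \sum_(1 <= j < m k) cmod (fcoef mu f (j * vM m k)%N) ^+ 2 =
    (m k - 1)%:R * b k ^+ 2.
  rewrite (eq_big_nat _ _ (F2 := fun=> b k ^+ 2)) => [|j jm].
    by rewrite sumr_const_nat mulr_natl.
  by rewrite coefE.
apply: series_pinftyI => [k k0|A].
  rewrite lee_fin sumE; have [->|/Phi_b Phik] := eqVneq (b k) 0.
    by rewrite expr0n !mulr0.
  apply: mulr_ge0; first by rewrite divr_ge0 ?powR_ge0.
  by apply: mulr_ge0 => //; exact: exprn_ge0.
have A0 : 0 < `|A| + 1 by rewrite ltr_wpDl.
have [n [n0 bn Phin An]] := Phi_w_big A0.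
(* A single term is already large, since m_n - 1 >= 1. *)
exists n, n.+1; split => //; rewrite big_nat1 lee_fin sumE.
apply: (@le_trans _ _ (Phi (vM m n) * w n ^+ 2)).
  by apply: le_trans An; have := ler_norm A; lra.
rewrite -mulrA; apply: ler_wpM2l => //; rewrite mulrCA.
have -> : ((vM m n)%:R `^ (2 / p - 2))^-1 * b n ^+ 2 = w n ^+ 2.
  have -> : b n ^+ 2 = w n ^+ 2 * (vM m n)%:R `^ (2 / p - 2).
    rewrite /weight -/(w n) exprMn; congr (_ * _).
    rewrite -powR_mulrn ?powR_ge0 // -powRrM; congr (_ `^ _).
    by rewrite mulrBl mul1r mulrC.
  by rewrite mulrCA mulVf ?mulr1 // gt_eqF // powR_gt0.
by rewrite ler_peMl ?exprn_ge0 // ler1n subn_gt0.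
Qed.

(** * Partial sums and their weak norms *)

Lemma vcoef_group s j : (j < m 0)%N ->
  vcoef m b (s * m 0 + j) = vcoef m b (s * m 0).
Proof.
move=> jm; case: s => [|s].
  (* The first group joins index 0 to level 0: index 0 has coefficient 0, and the others have b_0,
     which vanishes because v_0 = 0. *)
  rewrite mul0n add0n vcoef0 //; have [->|j0] := posnP j; first exact: vcoef0.
  by rewrite (@vcoef_level _ _ m2 _ 0) ?b_eq0 //= muln1 j0 jm.
have s0 : (0 < s.+1 * m 0)%N by rewrite muln_gt0 m_gt0.
have [n /andP[n1 n2]] := level_exists m2 s0.
rewrite [RHS](vcoef_level m2 b (n := n)) ?n1 //.
apply: (vcoef_level m2 b); apply/andP; split.
  by rewrite (leq_trans n1) ?leq_addr.
(* Since m_0 divides M_(n+1), a group that starts below M_(n+1) stays below it. *)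
have /dvdnP[q qE] := @vM_dvd m 1 n.+1 isT.
rewrite [vM m 1]/= muln1 in qE; move: n2; rewrite qE ltn_pmul2r // => sq.
apply: (@leq_trans (s.+2 * m 0)); last by rewrite leq_mul2r sq orbT.
by rewrite [X in (_ <= X)%N]mulSn addnC ltn_add2r.
Qed.

(** The t complete groups cancel, as zeta_0^(x_0) is a nontrivial m_0-th root of unity; the + 1
    leaves the single term of index t m_0. *)
Lemma fsum_group t (x : vilenkin m) : (0 < x 0)%N ->
  fsum mu f (t * m 0 + 1) x =
  (vcoef m b (t * m 0))%:C%C * psi R (t * m 0) x.
Proof.
move=> x0; have xm : (0 < x 0 < m 0)%N by rewrite x0 vlt_ord.
rewrite /fsum -(big_mkord xpredT (fun k => fcoef mu f k * psi R k x)) addn1.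
rewrite big_nat_recr //= fcoef_vmart // -[0%N in X in X + _](mul0n (m 0)).
rewrite big_nat_blocks // big1 ?add0r // => s _.
under eq_big_nat => j /andP[_ jm].
  rewrite fcoef_vmart // vcoef_group // psi_bottom // mulrA.
  over.
by rewrite -mulr_sumr sum_zeta // mulr0.
Qed.

Lemma fsum_local n : local n (fsum mu f n).
Proof.
move=> x y xy; rewrite /fsum; apply: eq_bigr => k _; congr (_ * _).
apply: (psi_local R m2 (vM_gt m2 k)) => j jk.
by apply: xy; exact: ltn_trans (ltn_ord k).
Qed.

Lemma weak_norm_fsum_ge t : 0 < vcoef m b (t * m 0) ->
  ((vcoef m b (t * m 0) / 2 * (m 0)%:R^-1 `^ p^-1)%:E <=
   weak_norm mu p (fsum mu f (t * m 0 + 1)))%E.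
Proof.
set c := vcoef _ _ _ => c0.
apply: le_trans (ereal_sup_ubound _); last first.
  (* Halving puts the threshold strictly below the modulus c of the partial sum. *)
  by exists (c / 2) => //=; exact: divr_gt0.
rewrite EFinM; apply: lee_wpmul2l; first by rewrite lee_fin divr_ge0 // ltW.
rewrite -poweR_EFin; apply: gt0_ler_poweR.
- by rewrite invr_ge0 ltW.
- by rewrite in_itv /= lee_fin invr_ge0 ler0n leey.
- by rewrite in_itv /= measure_ge0 leey.
(* Coordinate 0 of [word m 1] is 1, so this cell, of measure 1 / m_0, lies where x_0 <> 0. *)
have -> : ((m 0)%:R^-1)%:E = mu (vI 1 (word m 1)).
  by rewrite -[m 0]muln1; exact/esym/(mu_vI mu_haar 1).
apply: le_measure; rewrite ?inE.
- exact: measurable_vI.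
- exact: (local_measurable m2
    (local_preimage [set z | c / 2 < cmod z] (@fsum_local (t * m 0 + 1)))).
move=> x /(_ 0%N isT) x1 /=; rewrite fsum_group; last first.
  by rewrite x1 val_word // /vdigit /= divn1 modn_small.
rewrite ComplexField.Normc.normcM normc_psi mulr1 /= expr0n addr0 sqrtr_sqr.
rewrite gtr0_norm // -/c; lra.
Qed.

(** For the terms with Phi k < 0, whose partial sum vanishes identically. *)
Let weak_norm0 : weak_norm mu p (fun=> 0) = 0%E.
Proof.
have E l : 0 < l ->
    (l%:E * mu [set x : vilenkin m | (l < cmod (0 : R[i]))%R] `^ p^-1 = 0)%E.
  move=> l0; rewrite (_ : [set _ | _] = set0).
    by rewrite measure0 poweR0r ?mule0 // gt_eqF // invr_gt0.
  apply/seteqP; split => // x /=.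
  by rewrite expr0n addr0 sqrtr0 ltNge ltW.
apply/eqP; rewrite eq_le; apply/andP; split.
  by apply: ge_ereal_sup => _ [l /= l0 <-]; rewrite E.
by apply: ereal_sup_ubound; exists 1 => //=; rewrite E.
Qed.

(** The p-th power turns the measure factor into 1 / m_0 and the threshold factor into 2^(-p) >=
    1/4. *)
Let weak_norm_pow_ge n t : (0 < b n) -> (vM m n <= t * m 0 < 2 * vM m n)%N ->
  ((b n `^ p / (4 * (m 0)%:R))%:E <=
   weak_norm mu p (fsum mu f (t * m 0 + 1)) `^ p)%E.
Proof.
move=> bn tM; have cE := vcoef_first tM.
have /weak_norm_fsum_ge : 0 < vcoef m b (t * m 0) by rewrite cE.
rewrite {}cE => H; have y0 : 0 <= b n / 2 * (m 0)%:R^-1 `^ p^-1.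
  by rewrite mulr_ge0 ?powR_ge0 // divr_ge0.
apply: (@le_trans _ _ ((b n / 2 * (m 0)%:R^-1 `^ p^-1)%:E `^ p)%E); last first.
  apply: gt0_ler_poweR (H);
    rewrite ?in_itv /= ?lee_fin ?y0 ?leey ?(ltW p_gt0) //.
  by rewrite andbT; apply: le_trans H; rewrite lee_fin.
rewrite poweR_EFin lee_fin powRM ?powR_ge0 ?divr_ge0 //.
rewrite -powRrM mulVf ?gt_eqF //.
rewrite powRr1 ?invr_ge0 // powRM // invfM mulrA; apply: ler_wpM2r.
  by rewrite invr_ge0.
apply: ler_wpM2l; first exact: powR_ge0.
rewrite -[2^-1]powR_inv1 // -powRrM mulN1r powRN lef_pV2 ?posrE ?powR_gt0 //.
apply: (@le_trans _ _ (2 `^ 2%:R)); last by rewrite powR_mulrn // -natrX.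
by apply: ler_powR; rewrite ?ler1n.
Qed.

Lemma fsum_series : series_pinfty (fun k =>
  (weak_norm mu p (fsum mu f k) `^ p * (Phi k / k%:R `^ (2 - p))%:E)%E).
Proof.
set u := (fun _ => _).
have u0 k : (0 <= u k)%E.
  rewrite /u; have [Phik|c0] := Phi_vcoef k.
    by rewrite mule_ge0 ?poweR_ge0 // lee_fin divr_ge0 ?powR_ge0.
  rewrite (_ : fsum mu f k = fun=> 0) ?weak_norm0.
    by rewrite poweR0r ?mul0e // gt_eqF.
  apply/funext => x; rewrite /fsum big1 // => i _.
  by rewrite fcoef_vmart // c0 ?mul0r // ltnW.
apply: series_pinftyI => [k _|A]; first exact: u0.
(* A factor 4 comes from [block_const_ge], 4 m_0 from [weak_norm_pow_ge], and another m_0 from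
   keeping one index per group. *)
pose d : R := 16 * (m 0)%:R ^+ 2.
have m0 : 0 < (m 0)%:R :> R by rewrite ltr0n.
have d0 : 0 < d by rewrite mulr_gt0 // exprn_gt0.
have A0 : 0 < d * (`|A| + 1) by rewrite mulr_gt0 // ltr_wpDl.
have [n [n0 bn Phin An]] := Phi_w_big A0.
(* As n >= 1, M_n = q m_0, and [M_n, 2 M_n[ consists of q complete groups. *)
have /dvdnP[q qE] := @vM_dvd m 1 n n0; rewrite /= muln1 in qE.
exists (q * m 0)%N, (2 * q * m 0)%N; split.
- by rewrite -qE vM_gt0.
- by rewrite leq_mul2r leq_pmull ?orbT.
rewrite big_nat_blocks ?leq_pmull //.
pose c := block_const n / (4 * (m 0)%:R).
apply: (@le_trans _ _ (\sum_(q <= t < 2 * q) c%:E)%E).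
  rewrite sumEFin lee_fin sumr_const_nat mul2n -addnn addnK.
  have -> : c *+ q = (vM m n)%:R * block_const n / (4 * (m 0)%:R ^+ 2).
    have m0' : (m 0)%:R != 0 :> R by rewrite gt_eqF.
    rewrite qE natrM /c -mulr_natr.
    by field.
  rewrite ler_pdivlMr ?mulr_gt0 ?exprn_gt0 //.
  apply: le_trans (block_const_ge Phin).
  rewrite ler_pdivlMr //; apply: le_trans An.
  have := ler_norm A; rewrite /d => hA.
  have : A * (m 0)%:R ^+ 2 <= (`|A| + 1) * (m 0)%:R ^+ 2.
    by rewrite ler_pM2r ?exprn_gt0 //; lra.
  by lra.
rewrite big_nat [X in (_ <= X)%E]big_nat; apply: lee_sum => t /andP[t1 t2].
have tM : (vM m n <= t * m 0 < 2 * vM m n)%N.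
  by rewrite qE leq_mul2r t1 orbT mulnA ltn_pmul2r.
(* Of each group only the index t m_0 + 1 is kept; the other terms are nonnegative. *)
rewrite (bigD1_seq 1%N) ?iota_uniq ?mem_index_iota //=.
rewrite -[leLHS]addr0; apply: leeD; last by apply: sume_ge0 => j _; exact: u0.
have tk : (vM m n <= t * m 0 + 1 < 2 * vM m n)%N.
  case/andP: tM => h1 h2; rewrite (leq_trans h1) ?leq_addr //=.
  apply: (@leq_trans (t.+1 * m 0)); last by rewrite qE mulnA leq_mul2r t2 orbT.
  by rewrite mulSn addnC ltn_add2r.
apply: le_trans (lee_wpmul2r _ (weak_norm_pow_ge bn tM)); last first.
  have Phik : 0 <= Phi (t * m 0 + 1).
    apply: le_trans Phin _; apply: Phi_nd; first exact: vM_gt0.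
    by case/andP: tk.
  by rewrite lee_fin divr_ge0 ?powR_ge0.
rewrite -EFinM lee_fin /c [leRHS]mulrAC.
apply: ler_wpM2r; last exact: block_const_le.
by rewrite invr_ge0 mulr_ge0.
Qed.

End series.

(** * Sparse weights *)

Lemma sum_half (R : realType) n :
  \sum_(0 <= i < n) (2^-1 : R) ^+ i = 2 - 2 * 2^-1 ^+ n.
Proof.
elim: n => [|n IH]; first by rewrite big_geq // expr0 mulr1 subrr.
by rewrite big_nat_recr //= IH exprS; lra.
Qed.

(** The weight 2^(-i) is placed at a level a_i so remote that Psi outweighs its smallness there;
    elsewhere v is 0. *)
Lemma sparse_weights (R : realType) (Psi : nat -> R) (q : R) :
  (forall A, exists N : nat, forall n, (N <= n)%N -> A <= Psi n) ->
  exists v : nat -> R,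
    [/\ forall k, 0 <= v k, forall k, v k <= 1 & v 0 = 0] /\
    [/\ forall n, \sum_(0 <= k < n) v k <= 2,
        forall k, v k != 0 -> 0 <= Psi k &
        forall A, exists k, A <= Psi k * (v k * v k `^ q) ^+ 2].
Proof.
move=> HPsi; pose h i : R := 2^-1 ^+ i.
have h_gt0 i : 0 < h i by rewrite exprn_gt0 // invr_gt0.
(* Psi (a_i) >= T_i is what gives a product of at least i at the level a_i of weight h_i. *)
pose T i : R := i%:R / (h i * h i `^ q) ^+ 2.
have hq_gt0 i : 0 < (h i * h i `^ q) ^+ 2.
  by rewrite exprn_gt0 // mulr_gt0 // powR_gt0.
have [N NP] := choice (fun i => HPsi (T i)).
(* Summing the N_j + 1 makes a strictly increasing, with a_i >= N_i and a_i > i. *)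
pose a i := (\sum_(j < i.+1) (N j).+1)%N.
have aS i : a i.+1 = (a i + (N i.+1).+1)%N by rewrite /a big_ord_recr.
have a_gt i : (i < a i)%N.
  elim: i => [|i IH]; first by rewrite /a big_ord_recr big_ord0.
  by rewrite aS addnS ltnS (leq_trans IH) ?leq_addr.
have a_ge i : (N i <= a i)%N.
  by rewrite /a big_ord_recr /= addnS ltnW // ltnS leq_addl.
have a_lt i j : (i < j)%N -> (a i < a j)%N.
  by apply: (homo_ltn ltn_trans) => k; rewrite aS addnS ltnS leq_addr.
have a_inj i j : a i = a j -> i = j.
  by move=> aij; case: (ltngtP i j) => // /a_lt; rewrite aij ltnn.
(* As a_i > i, the indices i < n suffice to detect n = a_i; the empty sum gives v_0 = 0. *)
pose v n : R := \sum_(0 <= i < n) h i * (a i == n)%:R.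
have va i : v (a i) = h i.
  rewrite /v (bigD1_seq i) ?mem_index_iota ?iota_uniq ?a_gt //= eqxx mulr1.
  rewrite big1 ?addr0 // => j ji; rewrite (_ : a j == a i = false) ?mulr0 //.
  by apply: contraNF ji => /eqP/a_inj ->.
have v_cases n : v n = 0 \/ exists i, n = a i.
  have [[i ->]|nex] := pselect (exists i, n = a i); [by right; exists i|left].
  rewrite /v big1 // => i _; rewrite (_ : a i == n = false) ?mulr0 //.
  by apply/eqP => ain; apply: nex; exists i.
exists v; split; split.
- by move=> k; apply: sumr_ge0 => i _; rewrite mulr_ge0 // ltW.
- move=> k; have [->//|[i ->]] := v_cases k.
  by rewrite va exprn_ile1 // ?invr_ge0 // invf_le1 // ler1n.
- by rewrite /v big_geq.
(* The inner range is extended from i < k to i < n so that the sums can be exchanged; each h_i is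
   then counted at most once. *)
- move=> n; apply: (@le_trans _ _ (\sum_(0 <= k < n) \sum_(0 <= i < n)
      h i * (a i == k)%:R)).
    rewrite big_nat [leRHS]big_nat; apply: ler_sum => k /andP[_ kn].
    rewrite [leRHS](big_cat_nat (n := k)) ?(ltnW kn) //= lerDl.
    by apply: sumr_ge0 => i _; rewrite mulr_ge0 // ltW.
  rewrite exchange_big /=; apply: (@le_trans _ _ (\sum_(0 <= i < n) h i)).
    apply: ler_sum => i _; rewrite -mulr_sumr ler_piMr ?(ltW (h_gt0 i)) //.
    have -> : \sum_(0 <= k < n) (a i == k)%:R = (a i < n)%N%:R :> R.
      elim: n => [|n IH]; first by rewrite big_geq.
      by rewrite big_nat_recr //= IH ltnS; case: ltngtP; rewrite ?addr0 ?add0r.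
    by rewrite lern1 leq_b1.
  by rewrite sum_half gerBl mulr_ge0 // exprn_ge0 // invr_ge0.
- move=> k; have [->|[i ->]] := v_cases k; first by rewrite eqxx.
  move=> _; apply: le_trans (NP i _ (a_ge i)).
  by rewrite /T divr_ge0 // ltW.
(* Any i above |A| will do. *)
- move=> A; pose i := (Num.truncn `|A|).+1; exists (a i).
  rewrite va -ler_pdivrMr //; apply: le_trans (NP i _ (a_ge i)).
  rewrite /T ler_pM2r ?invr_gt0 //; apply: le_trans (ler_norm A) _.
  by apply: ltW; exact: truncnS_gt.
Qed.

(** * The weights adapted to Phi and p, and the conclusion *)

Theorem theorem1 (R : realType) (m : nat -> nat)
    (m_ge2 : forall k, (2 <= m k)%N) (m_bounded : bounded_seq m)
    (mu : probability (vilenkin m) R) (mu_haar : product_uniform mu)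
    (Phi : nat -> R)
    (Phi_nondecreasing : forall i j, (1 <= i)%N -> (i <= j)%N -> Phi i <= Phi j)
    (Phi_pinfty : Phi @ \oo --> +oo)
    (p : R) (p_gt0 : 0 < p) (p_le2 : p <= 2) :
  exists f : nat -> vilenkin m -> R[i],
    [/\ hardy mu p f,
        series_pinfty (fun k =>
          (cmod (fcoef mu f k) `^ p * Phi k / k%:R `^ (2 - p))%:E),
        p <= 1 -> series_pinfty (fun k =>
          (Phi (vM m k) / (vM m k)%:R `^ (2 / p - 2) *
           \sum_(1 <= j < m k) cmod (fcoef mu f (j * vM m k)%N) ^+ 2)%:E)
      & p < 1 -> series_pinfty (fun k =>
          (weak_norm mu p (fsum mu f k) `^ p *
           (Phi k / k%:R `^ (2 - p))%:E)%E)].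
Proof.
have Phi_vM A : exists N : nat, forall n, (N <= n)%N -> A <= Phi (vM m n).
  have [N _ NP] := (cvgryPge Phi).1 Phi_pinfty A.
  exists N => n Nn; apply: NP => /=; apply: leq_trans Nn _.
  by apply: ltnW; exact: vM_gt.
have [C mC] := m_bounded.
have [v [[v_ge0 v_le1 v0] [v_sum Phi_v Phi_w]]] := sparse_weights p^-1 Phi_vM.
exists (vmart (weight m p v)); split.
- exact: (vmart_hardy m_ge2 mu_haar p_gt0 mC).
- exact: fcoef_series.
- by move=> _; exact: fcoef_lacunary_series.
- by move=> _; exact: fsum_series.
Qed.
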